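(* Let $b_1,b_2>0$ and $a\in\mathbb{R}^+=(0,\infty)$, and let $m(x)=\frac{b_1}{x^8}-x-\frac{b_2}{x^2}$ for $x>0$ and $b_1^*=\frac{4}{27}b_2^3$. When $b_1<b_1^*$, let $x_l$ and $x_r$ denote respectively the local minimum point and the local maximum point of $m$ on $(0,\infty)$. The equilibrium solutions of the conservative system $$\dot x=y,\qquad \dot y=m(x)+a\qquad (x>0)$$ are classified as follows. 1. If either $b_1\ge b_1^*$ (and $a\in\mathbb{R}^+$ is arbitrary), or $b_1<b_1^*$ and $a\in\mathbb{R}^+\setminus[-m(x_r),-m(x_l)]$, then the equilibria consist of exactly one non-linear center. 2. If $b_1<b_1^*$ and $a\in(-m(x_r),-m(x_l))$, then the equilibria consist of exactly two non-linear centers and one saddle. 3. If $b_1<b_1^*$ and either $a=-m(x_r)$ or $a=-m(x_l)$, then the equilibria consist of exactly one non-linear center and one cusp.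
   Context: The system is the first-order form of $\ddot x=m(x)+a$ on $x>0$, which is the case $\epsilon=0$ of the AFM equation $\ddot x=m(x)+a+\epsilon\big(f(t)-\frac{C}{x^3}\dot x\big)$. Its equilibria are the points $(x,0)$ with $x>0$ and $m(x)+a=0$. Facts about $m$: if $b_1>b_1^*$, $m$ is decreasing. If $b_1=b_1^*$, $m$ is non-increasing with an inflection point at $x_c=(\frac43 b_2)^{1/3}$. If $0<b_1<b_1^*$, $m$ has exactly one local minimum point $x_l$ and exactly one local maximum point $x_r$ on $(0,\infty)$, with $m(x_l)<m(x_r)<0$. Terminology. A non-linear center is an equilibrium having a punctured neighborhood filled with periodic orbits of the nonlinear system surrounding it. A saddle is an equilibrium whose linearization has one positive and one negative real eigenvalue. A cusp is a degenerate isolated equilibrium with a neighborhood consisting of exactly two hyperbolic sectors and two separatrices (one tending to the equilibrium as $t\to+\infty$, the other as $t\to-\infty$). *)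

(* Defs.v *)
From HB Require Import structures.
From mathcomp Require Import all_boot all_order all_algebra.
From mathcomp Require Import all_classical all_reals all_analysis.

Set Implicit Arguments.
Unset Strict Implicit.
Unset Printing Implicit Defensive.

Import Order.TTheory GRing.Theory Num.Theory.
Import numFieldNormedType.Exports.

Local Open Scope classical_set_scope.
Local Open Scope ring_scope.

Definition vec2 {R : realType} (x y : R) : 'rV[R]_2 :=
  \row_j (if j == 0 then x else y).

Section PlanarSystems.
Context {R : realType}.
Local Notation plane := 'rV[R]_2.
Implicit Types (F : plane -> plane) (D S N : set plane) (p q : plane).

(* Throughout, F is a vector field and D the phase space: F may take junk
   values outside D, and solutions are required to stay in D. *)

Definition equilibria F D : set plane := [set p | D p /\ F p = 0].

(* gamma is a total function of time; only its restriction to I matters.  At an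
   endpoint of I the derivative is two-sided, i.e., the solution is prolonged
   by a differentiable curve, which costs no generality. *)
Definition is_solution F D (I : set R) (gamma : R -> plane) : Prop :=
  forall t, I t -> D (gamma t) /\ is_derive t 1 gamma (F (gamma t)).

Definition is_periodic_orbit F D (Gamma : set plane) : Prop :=
  exists (gamma : R -> plane) (T : R),
    [/\ is_solution F D setT gamma, 0 < T, periodic gamma T,
        exists t, gamma t != gamma 0 & Gamma = range gamma].

(* p lies in the interior of the closed curve Gamma, i.e., in the bounded
   connected component of its complement. *)
Definition surrounds (Gamma : set plane) p : Prop :=
  ~ Gamma p /\ bounded_set (connected_component (~` Gamma) p).

Definition nonlinear_center F D p : Prop :=
  equilibria F D p /\
  exists2 U : set plane, nbhs p U &
    forall q, (U `\ p) q ->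
      exists Gamma : set plane,
        [/\ is_periodic_orbit F D Gamma, Gamma q, Gamma `<=` U `\ p &
            surrounds Gamma p].

(* 'J acts on row vectors, so it is the transpose of the usual Jacobian
   matrix; eigenvalues and determinant are unaffected. *)
Definition saddle F D p : Prop :=
  [/\ equilibria F D p, differentiable F p &
      exists lambda mu : R,
        [/\ 0 < lambda, mu < 0, eigenvalue ('J F p) lambda &
            eigenvalue ('J F p) mu]].

Definition degenerate F p : Prop :=
  differentiable F p /\ \det ('J F p) = 0.

Definition isolated_equilibrium F D p : Prop :=
  equilibria F D p /\ \forall q \near p, equilibria F D q -> q = p.

(* q' is on the forward trajectory of q inside S. *)
Definition reaches F S q q' : Prop :=
  exists (T : R) (gamma : R -> plane),
    [/\ 0 <= T, is_solution F S `[0, T]%classic gamma,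
        gamma 0 = q & gamma T = q'].

Definition homeomorphism_onto (A B : set plane) (h : plane -> plane) : Prop :=
  [/\ set_bij A B h, {within A, continuous h} &
      exists2 g : plane -> plane,
        {within B, continuous g} & forall q, A q -> g (h q) = q].

(* Topological equivalence of G on A with F on B: h maps trajectories of G
   inside A onto trajectories of F inside B, preserving the orientation (but
   not necessarily the parametrization) by time. *)
Definition topological_equivalence (G : plane -> plane) (A : set plane)
    F (B : set plane) (h : plane -> plane) : Prop :=
  homeomorphism_onto A B h /\
  forall q q', A q -> A q' ->
    (reaches G A q q' <-> reaches F B (h q) (h q')).

(* Model hyperbolic sector: the first quadrant of u' = u, v' = - v, whose
   trajectories are the arcs of the hyperbolas u * v = const; it is bounded by
   an incoming half-axis (u = 0) and an outgoing half-axis (v = 0). *)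
Definition linear_saddle_field (q : plane) : plane :=
  vec2 (q ord0 0) (- q ord0 1).

Definition unit_square : set plane :=
  [set q | 0 <= q ord0 0 <= 1 /\ 0 <= q ord0 1 <= 1].

Definition model_incoming : set plane :=
  [set q | q ord0 0 = 0 /\ 0 < q ord0 1 <= 1].

Definition model_outgoing : set plane :=
  [set q | 0 < q ord0 0 <= 1 /\ q ord0 1 = 0].

(* S is a hyperbolic sector at p bounded by the separatrix arcs s_in, s_out. *)
Definition hyperbolic_sector F p S (s_in s_out : set plane) : Prop :=
  exists h : plane -> plane,
    [/\ topological_equivalence linear_saddle_field unit_square F S h,
        h 0 = p, h @` model_incoming = s_in & h @` model_outgoing = s_out].

Definition incoming_trajectory F D p (s : set plane) : Prop :=
  exists gamma : R -> plane,
    [/\ is_solution F D `[0, +oo[%classic gamma, gamma t @[t --> +oo] --> p &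
        s = gamma @` `[0, +oo[%classic].

Definition outgoing_trajectory F D p (s : set plane) : Prop :=
  exists gamma : R -> plane,
    [/\ is_solution F D `]-oo, 0]%classic gamma, gamma t @[t --> -oo] --> p &
        s = gamma @` `]-oo, 0]%classic].

Definition cusp F D p : Prop :=
  [/\ isolated_equilibrium F D p, degenerate F p &
      exists N S1 S2 s_in s_out : set plane,
        [/\ nbhs p N /\ N `<=` D,
            incoming_trajectory F D p s_in /\ outgoing_trajectory F D p s_out,
            hyperbolic_sector F p S1 s_in s_out /\
              hyperbolic_sector F p S2 s_in s_out,
            N = S1 `|` S2 &
            S1 `&` S2 = [set p] `|` s_in `|` s_out]].

Definition one_center F D : Prop :=
  exists p, equilibria F D = [set p] /\ nonlinear_center F D p.

Definition two_centers_one_saddle F D : Prop :=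
  exists p1 p2 p3,
    [/\ [/\ p1 != p2, p1 != p3 & p2 != p3],
        equilibria F D = [set p1; p2; p3],
        nonlinear_center F D p1, nonlinear_center F D p2 & saddle F D p3].

Definition one_center_one_cusp F D : Prop :=
  exists p1 p2,
    [/\ p1 != p2, equilibria F D = [set p1; p2],
        nonlinear_center F D p1 & cusp F D p2].

End PlanarSystems.

Definition local_min_point {R : realType} (A : set R) (f : R -> R) (x : R) :=
  A x /\ \forall y \near within A (nbhs x), f x <= f y.

Definition local_max_point {R : realType} (A : set R) (f : R -> R) (x : R) :=
  A x /\ \forall y \near within A (nbhs x), f y <= f x.

Definition afm_m {R : realType} (b1 b2 x : R) : R :=
  b1 / x ^+ 8 - x - b2 / x ^+ 2.

Definition b1_star {R : realType} (b2 : R) : R := 4 / 27 * b2 ^+ 3.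

Definition afm_field {R : realType} (b1 b2 a : R) (p : 'rV[R]_2) : 'rV[R]_2 :=
  vec2 (p ord0 1) (afm_m b1 b2 (p ord0 0) + a).

Definition right_half_plane {R : realType} : set 'rV[R]_2 :=
  [set p | 0 < p ord0 0].

(* Main.v *)
Require Import Defs.
From HB Require Import structures.
From mathcomp Require Import all_boot all_order all_algebra ring lra.
From mathcomp Require Import all_classical all_reals all_analysis.
Import Order.TTheory GRing.Theory Num.Theory.
Import numFieldNormedType.Exports.
Local Open Scope classical_set_scope.
Local Open Scope ring_scope.
Set Implicit Arguments.
Unset Strict Implicit.
Unset Printing Implicit Defensive.

(** With [f = m + a] and [G] a primitive of [f], the energy
    [H (x, y) = y^2 / 2 - G x] is conserved.  Near an equilibrium [f] is
    truncated to a globally Lipschitz function, so that the flow is complete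
    and unique (Picard, Gronwall) and coincides with the original one on the
    energy levels of interest.

    If [f] is positive on the left and negative on the right of [x0], an orbit
    of low energy is trapped; the signs of [f] force [y] to vanish at two times
    [t1 < t2], and since [(x (t), y (t)) -> (x (- t), - y (- t))] preserves the
    equation, the orbit is symmetric about [t1] and about [t2], hence periodic
    with period [2 (t2 - t1)].  It fills its whole energy level, which bounds
    the sublevel set containing the equilibrium.  This covers the degenerate
    minimum of the potential that occurs for [b1 = b1_star b2].

    If [f > 0] on both sides of a double zero [x0] of [f], then [G] is strictly
    increasing and [(y, H)] are coordinates near the equilibrium in which every
    trajectory keeps [H] fixed and increases [y], with the origin as only
    obstacle.  In the quadrant model [u' = u, v' = - v] the coordinates
    [(u - v, u v)] behave in the same way, so
    [y = delta (u - v), H = + delta u v] and [y = delta (u - v),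
    H = - delta u v] are the two hyperbolic sectors.  The case [f < 0] follows
    by the point reflection [q -> - q].

    Finally [m'(x) = P (x^3) / x^9] with [P z = - z^3 + 2 b2 z^2 - 8 b1], whose
    maximum on the positive axis is at [z = 4/3 b2] and has the sign of
    [b1_star b2 - b1]. *)

(** * Primitives and monotonicity on the line *)

Section Calculus.
Context {R : realType}.
Implicit Types (f df : R -> R) (a b t : R).

Lemma is_derive1_continuous f t d : is_derive t 1 f d -> {for t, continuous f}.
Proof.
by move=> [/derivable1_diffP /differentiable_continuous].
Qed.

Lemma is_derive1_within f df a b :
  (forall t, a <= t <= b -> is_derive t 1 f (df t)) ->
  {within `[a, b], continuous f}.
Proof.
move=> fd; apply: derivable_within_continuous => t.
by rewrite in_itv/= => /fd [].
Qed.

Lemma is_derive1_MVT f df a b : a <= b ->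
  (forall t, a <= t <= b -> is_derive t 1 f (df t)) ->
  exists2 c, a <= c <= b & f b - f a = df c * (b - a).
Proof.
move=> ab fd; have fd' t : t \in `]a, b[ -> is_derive t 1 f (df t).
  rewrite in_itv/= => /andP[at_ tb]; apply: fd.
  by rewrite (ltW at_) (ltW tb).
have [c] := MVT_segment ab fd' (is_derive1_within fd).
by rewrite in_itv/= => cab ->; exists c.
Qed.

Lemma is_derive1_ge0_le f df a b : a <= b ->
  (forall t, a <= t <= b -> is_derive t 1 f (df t)) ->
  (forall t, a <= t <= b -> 0 <= df t) -> f a <= f b.
Proof.
move=> ab fd df0; have [c cab E] := is_derive1_MVT ab fd.
by rewrite -subr_ge0 E mulr_ge0 ?df0// subr_ge0.
Qed.

Lemma is_derive1_gt0_lt f df a b : a < b ->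
  (forall t, a <= t <= b -> is_derive t 1 f (df t)) ->
  (forall t, a < t < b -> 0 < df t) -> f a < f b.
Proof.
move=> ab fd df0; have fd' t : t \in `]a, b[ -> is_derive t 1 f (df t).
  rewrite in_itv/= => /andP[at_ tb]; apply: fd.
  by rewrite (ltW at_) (ltW tb).
have [c] := MVT ab fd' (is_derive1_within fd).
rewrite in_itv/= => cab E.
by rewrite -subr_gt0 E mulr_gt0 ?df0// subr_gt0.
Qed.

Lemma is_derive1_eq0_cst f a b :
  (forall t, a <= t <= b -> is_derive t 1 f 0) ->
  forall s t, a <= s <= b -> a <= t <= b -> f s = f t.
Proof.
move=> fd s t; wlog st : s t / s <= t => [H|].
  by case: (leP s t) => [/H//|/ltW/H{}H ? ?]; rewrite H.
move=> /andP[as_ sb] /andP[at_ tb].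
have fd' r : s <= r <= t -> is_derive r 1 f 0.
  move=> /andP[sr rt]; apply: fd.
  by rewrite (le_trans as_ sr) (le_trans rt tb).
have [c _] := is_derive1_MVT st fd'.
by rewrite mul0r => /eqP; rewrite subr_eq0 => /eqP.
Qed.

Lemma is_derive1_affine_comp f (k b t d : R) : is_derive (k * t + b) 1 f d ->
  is_derive t 1 (fun s => f (k * s + b)) (k * d).
Proof.
move=> fd.
have := @is_derive1_comp _ f (fun s => k * s + b) t d k fd.
rewrite mulrC; apply.
by apply: is_derive_eq; rewrite /GRing.scale/= mulr1 addr0.
Qed.

Lemma is_derive1_pos_ge0 f df : (forall t, is_derive t 1 f (df t)) ->
  f 0 = 0 -> (forall t, 0 <= t -> 0 <= df t) -> forall t, 0 <= t -> 0 <= f t.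
Proof.
move=> fd f0 df0 t t0; rewrite -f0; apply: (@is_derive1_ge0_le f df) => //.
by move=> s /andP[/df0].
Qed.

Lemma is_derive1_neg_le0 f df : (forall t, is_derive t 1 f (df t)) ->
  f 0 = 0 -> (forall t, t <= 0 -> 0 <= df t) -> forall t, t <= 0 -> f t <= 0.
Proof.
move=> fd f0 df0 t t0; rewrite -f0; apply: (@is_derive1_ge0_le f df) => //.
by move=> s /andP[_ /df0].
Qed.

(** Integrating twice from [0], in either direction of time, preserves the sign. This is the
    comparison principle behind the weighted bounds on the Picard iterates. *)
Lemma is_derive2_ge0 f df d2f : (forall t, is_derive t 1 f (df t)) ->
  (forall t, is_derive t 1 df (d2f t)) -> f 0 = 0 -> df 0 = 0 ->
  (forall t, 0 <= d2f t) -> forall t, 0 <= f t.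
Proof.
move=> fd dfd f0 df0 d2f0 t; have [t0|/ltW t0] := leP 0 t.
  apply: (@is_derive1_pos_ge0 f df) => // s s0.
  exact: (@is_derive1_pos_ge0 df d2f).
rewrite -oppr_le0; apply: (@is_derive1_neg_le0 (fun s => - f s) (fun s => - df s)) => //.
  by rewrite f0 oppr0.
move=> s s0; rewrite oppr_ge0; exact: (@is_derive1_neg_le0 df d2f).
Qed.

(* The fundamental theorem of calculus of the library is one-sided: it gives a
   primitive to the right of the base point only. *)
Lemma primitive_gtN1 (u : R -> R) : continuous u ->
  exists U : R -> R, U 0 = 0 /\ forall t, -1 < t -> is_derive t 1 U (u t).
Proof.
move=> cu.
pose V x := (\int[lebesgue_measure]_(s in `[-1%R, x]) u s)%R.
have dV t : -1 < t -> is_derive t 1 V (u t).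
  move=> t1.
  have [||d1 d2] := @continuous_FTC1_closed R u (-1) t (t + 1) _ _ t1 (cu t).
  - by rewrite ltrDl.
  - apply: continuous_compact_integrable; first exact: segment_compact.
    exact/continuous_subspaceT.
  by apply: (DeriveDef d1); rewrite -derive1E.
exists (fun x => V x - V 0); split; first by rewrite subrr.
by move=> t /dV ?; apply: is_derive_eq; rewrite subr0.
Qed.

(** A right-hand primitive of [u] is glued to the reflection of one of [s -> - u (- s)]. Both are
    valid on []-1, 1[] and agree there, so the derivative at the junction [0] is two-sided. *)
Lemma primitive_exists (u : R -> R) : continuous u ->
  exists U : R -> R, U 0 = 0 /\ forall t, is_derive t 1 U (u t).
Proof.
move=> cu.
have [A [A0 dA]] := primitive_gtN1 cu.
have cu' : continuous (fun s => - u (- s)).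
  move=> s; apply: continuousN; apply: continuous_comp; last exact: cu.
  exact: opp_continuous.
have [B [B0 dB]] := primitive_gtN1 cu'.
have dB' t : t < 1 -> is_derive t 1 (fun s => B (- s)) (u t).
  move=> t1; have := @is_derive1_affine_comp B (-1) 0 t (- u t).
  have -> : (fun s => B (-1 * s + 0)) = (fun s => B (- s)).
    by apply/funext => s; rewrite addr0 mulN1r.
  rewrite mulrNN mul1r; apply; rewrite addr0 mulN1r.
  by have := dB (- t); rewrite opprK; apply; lra.
have AB t : -1 < t < 1 -> A t = B (- t).
  move=> /andP[t1 t2]; apply/eqP; rewrite -subr_eq0; apply/eqP.
  (* A closed symmetric segment inside []-1, 1[]: the constancy lemma needs derivatives at its
     endpoints too. *)
  have [e e0 te] : exists2 e, e < 1 & `|t| <= e.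
    by exists `|t| => //; rewrite ltr_norml t1.
  rewrite (@is_derive1_eq0_cst (fun t => A t - B (- t)) (- e) e _ t 0).
  - by rewrite oppr0 A0 B0 subrr.
  - move=> s /andP[s1 s2].
    have dAs : is_derive s 1 A (u s) by apply: dA; lra.
    have dBs : is_derive s 1 (fun s => B (- s)) (u s) by apply: dB'; lra.
    by apply: is_derive_eq; rewrite subrr.
  - by rewrite -ler_norml.
  - by move: te; have := normr_ge0 t; lra.
exists (fun t => if 0 <= t then A t else B (- t)); split; first by rewrite lexx.
move=> t; have [t0|t0] := leP 0 t.
  apply: (@near_eq_is_derive _ _ _ A); last by apply: dA; lra.
  have : -1 < t by lra.
  move=> /lt_nbhsr; apply: filterS => s s1.
  by case: ifPn => //; rewrite -ltNge => s0; apply: AB; lra.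
apply: (@near_eq_is_derive _ _ _ (fun s => B (- s))); last by apply: dB'; lra.
have : t < 1 by lra.
move=> /lt_nbhsl; apply: filterS => s s1.
by case: ifPn => // s0; rewrite AB//; lra.
Qed.

End Calculus.

(** * Global existence and uniqueness for Newton equations *)

Section Picard.
Context {R : realType}.

Definition newton_at (g x y : R -> R) (t : R) :=
  is_derive t 1 x (y t) /\ is_derive t 1 y (g (x t)).

Definition newton_solution (g x y : R -> R) := forall t, newton_at g x y t.

Variables (g : R -> R) (L : R).
Hypothesis gL : forall x y, `|g x - g y| <= L * `|x - y|.

Lemma lipschitz_ge0 : 0 <= L.
Proof.
have := gL 1 0; rewrite subr0 normr1 mulr1; apply: le_trans.
exact: normr_ge0.
Qed.

Lemma lipschitz_cts : continuous g.
Proof.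
have L0 := lipschitz_ge0.
move=> t; apply/cvgrPdist_le => e e0; near=> s.
apply: le_trans (gL t s) _.
have : `|t - s| <= e / (L + 1).
  near: s; apply: cvgr_dist_le; first exact: cvg_id.
  by rewrite divr_gt0//; lra.
rewrite ler_pdivlMr; last lra.
by have := normr_ge0 (t - s); nra.
Unshelve. all: by end_near. Qed.

(* Iterates are compared in the weight [w]: since [w'' = K^2 w], integrating
   twice gains the factor [1 / K^2 <= 1 / (2 L)] on the whole line at once. *)
Let K : R := 1 + 2 * L.
Let w (t : R) : R := expR (K * t) + expR (- K * t).

Let K1 : 1 <= K. Proof. by have := lipschitz_ge0; rewrite /K; lra. Qed.

(** Lets the weight absorb the linear term [y0 * t] of the first iterate. *)
Let w1 t : 1 + `|t| <= w t.
Proof.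
have e1 := expR_ge1Dx (K * t); have e2 := expR_ge1Dx (- K * t).
have p1 := expR_gt0 (K * t); have p2 := expR_gt0 (- K * t).
have k1 := K1; rewrite /w; have [t0|t0] := leP 0 t.
  by rewrite ger0_norm//; nra.
by rewrite ltr0_norm//; nra.
Qed.

Let w2 t : 2 <= w t.
Proof.
have := expR_gt0 (K * t); have := expRN (K * t); rewrite /w -mulNr => ->.
move: (expR _) => z z0; rewrite -subr_ge0.
have -> : z + z^-1 - 2 = (z - 1) ^+ 2 / z by field; exact: lt0r_neq0.
by rewrite divr_ge0 ?sqr_ge0// ltW.
Qed.

Let dw (t : R) : is_derive t 1 w (K * (expR (K * t) - expR (- K * t))).
Proof.
have e1 := @is_derive1_affine_comp _ expR K 0 t _ (is_derive_expR _).
have e2 := @is_derive1_affine_comp _ expR (- K) 0 t _ (is_derive_expR _).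
have -> : w = (fun t => expR (K * t + 0) + expR (- K * t + 0)).
  by apply/funext => s; rewrite !addr0.
by apply: is_derive_eq; rewrite !addr0; ring.
Qed.

Let ddw (t : R) : is_derive t 1 (fun t => K * (expR (K * t) - expR (- K * t))) (K ^+ 2 * w t).
Proof.
have e1 := @is_derive1_affine_comp _ expR K 0 t _ (is_derive_expR _).
have e2 := @is_derive1_affine_comp _ expR (- K) 0 t _ (is_derive_expR _).
have -> : (fun t => K * (expR (K * t) - expR (- K * t))) =
   (fun t => K * (expR (K * t + 0) - expR (- K * t + 0))).
  by apply/funext => s; rewrite !addr0.
by apply: is_derive_eq; rewrite !addr0 /GRing.scale/= /w; ring.
Qed.

(** Compare [U] with [A / K ^+ 2 * (w t - 2)]: its second derivative [A * w t] dominates [u], and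
    since [w 0 = 2] it vanishes at [0] together with its first derivative. *)
Let bound1 (A : R) (U V u : R -> R) : 0 <= A ->
  (forall t : R, is_derive t 1 U (V t)) -> (forall t : R, is_derive t 1 V (u t)) ->
  U 0 = 0 -> V 0 = 0 -> (forall t, u t <= A * w t) ->
  forall t, U t <= A / K ^+ 2 * w t.
Proof.
move=> A0 dU dV U0 V0 uA t; have K0 : K != 0 by have := K1; lra.
set B := A / K ^+ 2.
have B0 : 0 <= B by rewrite divr_ge0// sqr_ge0.
suff : 0 <= B * (w t - 2) - U t by nra.
apply: (@is_derive2_ge0 _ (fun t => B * (w t - 2) - U t)
  (fun t => B * (K * (expR (K * t) - expR (- K * t))) - V t)
  (fun t => A * w t - u t)).
- move=> s; apply: is_derive_eq; rewrite /GRing.scale/=; ring.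
- move=> s; have ? := ddw s; apply: is_derive_eq; rewrite /GRing.scale/= /B.
  by field.
- by rewrite /w !mulr0 expR0 U0; ring.
- by rewrite !mulr0 expR0 V0; ring.
- by move=> s; rewrite subr_ge0.
Qed.

Let bound (A : R) (U V u : R -> R) : 0 <= A ->
  (forall t : R, is_derive t 1 U (V t)) -> (forall t : R, is_derive t 1 V (u t)) ->
  U 0 = 0 -> V 0 = 0 -> (forall t, `|u t| <= A * w t) ->
  forall t, `|U t| <= A / K ^+ 2 * w t.
Proof.
move=> A0 dU dV U0 V0 uA t; rewrite ler_norml; apply/andP; split; last first.
  apply: (bound1 A0 dU dV) => // s.
  exact: le_trans (ler_norm _) (uA s).
rewrite lerNl; apply: (@bound1 _ (fun t => - U t) (fun t => - V t) (fun t => - u t)) => //.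
- by rewrite U0 oppr0.
- by rewrite V0 oppr0.
- move=> s; apply: le_trans (uA s); rewrite -normrN; exact: ler_norm.
Qed.

Let K2 (A : R) : 0 <= A -> L * A / K ^+ 2 <= A / 2.
Proof.
have K0 : 0 < K ^+ 2 by rewrite exprn_gt0//; have := K1; lra.
have := lipschitz_ge0 => L0 A0; rewrite ler_pdivrMr//.
have : L <= K ^+ 2 / 2 by rewrite /K; nra.
by nra.
Qed.

(** Choice turns double integration from [0] into an operator on all functions, so that it can be
    iterated; its value on discontinuous functions is arbitrary. *)
Let double_primitive : exists D : (R -> R) -> (R -> R), forall u : R -> R, continuous u ->
  exists V : R -> R, [/\ D u 0 = 0, V 0 = 0,
   forall t : R, is_derive t 1 (D u) (V t) & forall t : R, is_derive t 1 V (u t)].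
Proof.
suff H (u : R -> R) : exists U : R -> R, continuous u ->
  exists V : R -> R, [/\ U 0 = 0, V 0 = 0,
   forall t : R, is_derive t 1 U (V t) & forall t : R, is_derive t 1 V (u t)].
  by have [D HD] := choice H; exists D.
have [cu|cu] := pselect (continuous u); last by exists u.
have [V [V0 dV]] := primitive_exists cu.
have cV : continuous V by move=> t; have := dV t; exact: is_derive1_continuous.
by have [U [U0 dU]] := primitive_exists cV; exists U => _; exists V.
Qed.

Section Iteration.
Variables (x0 y0 : R) (D : (R -> R) -> (R -> R)).
Hypothesis DP : forall u : R -> R, continuous u ->
  exists V : R -> R, [/\ D u 0 = 0, V 0 = 0,
   forall t : R, is_derive t 1 (D u) (V t) & forall t : R, is_derive t 1 V (u t)].

(** The integral form of [x'' = g x] with data [x0], [y0]. Working with the second-order equation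
    keeps the iteration scalar; the velocity is recovered from the inner primitive. *)
Let T u (t : R) : R := x0 + y0 * t + D (g \o u) t.

Let cg (u : R -> R) : continuous u -> continuous (g \o u).
Proof. by move=> cu t; apply: continuous_comp; [exact: cu|exact: lipschitz_cts]. Qed.

Let cT (u : R -> R) : continuous u -> continuous (T u).
Proof.
move=> cu t; have [V [_ _ dD _]] := DP (cg cu).
have := dD t => ?; apply: (@is_derive1_continuous _ _ _ (y0 + V t)).
by apply: is_derive_eq; rewrite /GRing.scale/=; ring.
Qed.

Let contraction (A : R) (u v : R -> R) : 0 <= A -> continuous u -> continuous v ->
  (forall t, `|u t - v t| <= A * w t) ->
  forall t, `|T u t - T v t| <= A / 2 * w t.
Proof.
move=> A0 cu cv uv t.
have [U1 [D1 V1 dD1 dU1]] := DP (cg cu).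
have [U2 [D2 V2 dD2 dU2]] := DP (cg cv).
have -> : T u t - T v t = D (g \o u) t - D (g \o v) t by rewrite /T; ring.
have LA0 : 0 <= L * A by rewrite mulr_ge0// lipschitz_ge0.
have H := @bound (L * A) (fun t => D (g \o u) t - D (g \o v) t)
  (fun t => U1 t - U2 t) (fun t => g (u t) - g (v t)) LA0.
apply: le_trans (H _ _ _ _ _ t) _.
- by rewrite D1 D2 subrr.
- by rewrite V1 V2 subrr.
- move=> s; apply: le_trans (gL _ _) _; rewrite -mulrA.
  by apply: ler_wpM2l; [exact: lipschitz_ge0|exact: uv].
apply: ler_wpM2r; last exact: K2.
by have := w2 t; lra.
Qed.

Let X n : R -> R := iter n T (fun=> x0).

Let cX n : continuous (X n).
Proof. by elim: n => [|n ih]; [move=> t; exact: cvg_cst|exact: cT]. Qed.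

Let A : R := `|y0| + `|g x0|.
Let A0 : 0 <= A. Proof. by rewrite addr_ge0. Qed.

Let stepX n (t : R) : `|X n.+1 t - X n t| <= A * (1 / 2) ^+ n * w t.
Proof.
elim: n t => [|n ih] t; last first.
  have -> : A * (1 / 2) ^+ n.+1 = A * (1 / 2) ^+ n / 2 by rewrite exprS; field.
  apply: (@contraction _ (X n.+1) (X n) _ (@cX n.+1) (@cX n) ih).
  by rewrite mulr_ge0// exprn_ge0//; lra.
rewrite expr0 mulr1 /X/= /T.
have -> : x0 + y0 * t + D (g \o (fun=> x0)) t - x0 = y0 * t + D (g \o (fun=> x0)) t.
  by ring.
have [U [D1 V1 dD1 dU1]] := DP (cg (@cst_continuous R R x0)).
have H := @bound `|g x0| (D (g \o (fun=> x0))) U _ (normr_ge0 _) dD1 dU1 D1 V1.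
apply: le_trans (ler_normD _ _) _; rewrite /A mulrDl lerD//.
  rewrite normrM ler_wpM2l//; have := w1 t; lra.
apply: le_trans (H _ t) _.
  by move=> s /=; rewrite ler_peMr//; have := w2 s; lra.
have k1 := K1; apply: ler_wpM2r; first by have := w2 t; lra.
by rewrite ler_pdivrMr ?exprn_gt0//; last lra; rewrite ler_peMr//; nra.
Qed.

(** The factor [1 - (1 / 2) ^+ k] is the exact partial geometric sum, so the induction on [k] closes
    as an identity. *)
Let stepX' n k t : `|X (n + k)%N t - X n t| <= 2 * A * (1 / 2) ^+ n * w t * (1 - (1 / 2) ^+ k).
Proof.
elim: k => [|k ih]; first by rewrite addn0 expr0 !subrr normr0 mulr0.
have -> : X (n + k.+1)%N t - X n t =
  (X (n + k).+1 t - X (n + k)%N t) + (X (n + k)%N t - X n t) by rewrite addnS; ring.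
apply: le_trans (ler_normD _ _) _.
apply: le_trans (lerD (stepX _ _) ih) _.
by rewrite exprD exprS le_eqVlt; apply/orP; left; apply/eqP; field.
Qed.

Let stepX'' n k t : `|X (n + k)%N t - X n t| <= 2 * A * (1 / 2) ^+ n * w t.
Proof.
apply: le_trans (stepX' _ _ _) _; rewrite ler_piMr//.
  by rewrite !mulr_ge0// ?exprn_ge0//; have := w2 t; lra.
Qed.

Let cvgX t : cvgn (fun n => X n t).
Proof.
have -> : (fun n => X n t) = (fun n => X 0 t + series (telescope (X ^~ t)) n).
  by apply/funext => n; rewrite [LHS](eq_sum_telescope (X ^~ t)).
apply: is_cvgD; first exact: is_cvg_cst.
apply: normed_cvg; apply: (@series_le_cvg _ _ (geometric (A * w t) (1 / 2))) => //.
- by move=> n; exact: normr_ge0.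
- by move=> n /=; rewrite !mulr_ge0// ?exprn_ge0//; have := w2 t; lra.
- move=> n /=; rewrite /telescope; apply: le_trans (stepX _ _) _.
  by rewrite le_eqVlt; apply/orP; left; apply/eqP; ring.
- by apply: is_cvg_geometric_series; rewrite ger0_norm; lra.
Qed.

Let Y t : R := limn (fun n => X n t).

Let XY n t : `|Y t - X n t| <= 2 * A * (1 / 2) ^+ n * w t.
Proof.
have cv : `|X k t - X n t| @[k --> \oo] --> `|Y t - X n t|.
  apply: cvg_norm; apply: cvgB; [exact: cvgX|exact: cvg_cst].
have /cvg_lim <- := cv; last exact: Rhausdorff.
apply: limr_le; first by apply/cvg_ex; eexists; exact: cv.
exists n => // k /= nk; rewrite -(subnKC nk); exact: stepX''.
Qed.

Let small (C e : R) : 0 <= C -> 0 < e -> exists n, C * (1 / 2) ^+ n < e.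
Proof.
move=> C0 e0.
have h1 : `|1 / 2 : R| < 1 by rewrite ger0_norm; lra.
have /cvgr_lt /(_ e e0) [n _ nC] := @cvg_geometric R C (1/2) h1.
by exists n; exact: (nC n (leqnn n)).
Qed.

Let cY : continuous Y.
Proof.
move=> t; apply/cvgrPdist_le => e e0.
(* [w t + 1] bounds the weight near [t], so a single index [n] serves all nearby times in the
   three-term estimate. *)
have [||n nC] := @small (2 * A * (w t + 1)) (e / 3).
- by have := w2 t; have := A0; nra.
- by lra.
have E : 2 * A * (w t + 1) * (1 / 2) ^+ n = 2 * A * (1 / 2) ^+ n * (w t + 1) by ring.
rewrite {}E in nC; near=> s.
have -> : Y t - Y s = (Y t - X n t) + (X n t - X n s) - (Y s - X n s) by ring.
apply: le_trans (ler_normB _ _) _; apply: le_trans (lerD (ler_normD _ _) (lexx _)) _.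
have s1 : w s < w t + 1.
  near: s; apply: cvgr_lt; [exact: (is_derive1_continuous (dw t))|lra].
have s2 : `|X n t - X n s| <= e / 3.
  near: s; apply: cvgr_dist_le; [exact: cX|lra].
have p : 0 <= 2 * A * (1 / 2) ^+ n by rewrite !mulr_ge0// exprn_ge0//; lra.
have := XY n t; have := XY n s.
have : 2 * A * (1 / 2) ^+ n * w s <= 2 * A * (1 / 2) ^+ n * (w t + 1).
  by rewrite ler_wpM2l// ltW.
by lra.
Unshelve. all: by end_near. Qed.

(** No limit is exchanged with an integral: [Y - X n.+1] is small by the error bound, and
    [T Y - T (X n)] by the same bound and the contraction. *)
Let fixY t : Y t = T Y t.
Proof.
apply/eqP; rewrite -subr_eq0 -normr_eq0; apply: contraT => neq.
have := normr_ge0 (Y t - T Y t); rewrite le_eqVlt eq_sym (negbTE neq)/= => e0.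
have [|n nC] := @small (2 * A * w t) _ _ e0.
  by rewrite !mulr_ge0//; have := w2 t; lra.
suff : `|Y t - T Y t| <= 2 * A * w t * (1 / 2) ^+ n by lra.
have -> : Y t - T Y t = (Y t - X n.+1 t) - (T Y t - T (X n) t) by rewrite /X/=; ring.
apply: le_trans (ler_normB _ _) _.
apply: le_trans (lerD (XY _ _) (@contraction (2 * A * (1 / 2) ^+ n) Y (X n) _ cY (@cX n) (XY n) t)) _.
  by rewrite !mulr_ge0// exprn_ge0//; lra.
by rewrite exprS le_eqVlt; apply/orP; left; apply/eqP; field.
Qed.

Lemma picard_solution : exists x y, [/\ newton_solution g x y, x 0 = x0 & y 0 = y0].
Proof.
have [V [D1 V1 dD dV]] := DP (cg cY).
exists Y, (fun t => y0 + V t); split.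
- move=> t; split.
    have -> : Y = T Y by apply/funext => s; exact: fixY.
    have ? := dD t.
    by rewrite -[T Y]/(fun t => T Y t) /T; apply: is_derive_eq; rewrite /GRing.scale/=; ring.
  by have := is_deriveD (is_derive_cst y0 t 1) (dV t); rewrite add0r; exact.
- by rewrite fixY /T D1; ring.
- by rewrite V1 addr0.
Qed.

End Iteration.

Theorem newton_solution_exists (x0 y0 : R) :
  exists x y, [/\ newton_solution g x y, x 0 = x0 & y 0 = y0].
Proof. by have [D DP] := double_primitive; exact: picard_solution DP. Qed.

End Picard.

(** * Symmetries, uniqueness and conservation of energy *)

Section NewtonDynamics.
Context {R : realType}.

(** With [b = r + r] this is reflection of time about [r], the source of periodicity; with [b = 0]
    it turns the incoming separatrix of a cusp into the outgoing one. *)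
Lemma newton_reverse (g x y : R -> R) (b t : R) : newton_at g x y (b - t) ->
  newton_at g (fun s => x (b - s)) (fun s => - y (b - s)) t.
Proof.
have E s : -1 * s + b = b - s by ring.
move=> [dx dy]; split.
  have := @is_derive1_affine_comp _ x (-1) b t (y (b - t)).
  by rewrite E mulN1r; under eq_fun do rewrite E; exact.
have := @is_derive1_affine_comp _ y (-1) b t (g (x (b - t))).
rewrite E; under eq_fun do rewrite E.
by move=> /(_ dy) H; have := is_deriveN H; rewrite mulN1r opprK; exact.
Qed.

(** Exchanges left and right, so that a statement about the right side of a well also yields the one
    about its left side. *)
Lemma newton_flip (g x y : R -> R) (t : R) : newton_at g x y t ->
  newton_at (fun z => - g (- z)) (fun s => - x s) (fun s => - y s) t.
Proof.
by move=> [dx dy]; split; [exact: is_deriveN dx|rewrite opprK; exact: is_deriveN dy].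
Qed.

Lemma newton_energy (g G x y : R -> R) (t : R) :
  (forall z : R, is_derive z 1 G (g z)) -> newton_at g x y t ->
  is_derive t 1 (fun s => y s ^+ 2 / 2 - G (x s)) 0.
Proof.
move=> dG [dx dy].
have dGx := is_derive1_comp (dG (x t)) dx.
have -> : (fun s => y s ^+ 2 / 2 - G (x s)) = (2^-1 *: (y * y) - (G \o x)).
  by apply/funext => s; rewrite /= !fctE /= /GRing.scale/=; field.
by apply: is_derive_eq; rewrite /GRing.scale/=; field.
Qed.

Section Uniqueness.
Variables (g : R -> R) (L : R).
Hypothesis gL : forall x y, `|g x - g y| <= L * `|x - y|.
Variables (x1 y1 x2 y2 : R -> R) (a b : R).
Hypotheses (sol1 : forall t, a <= t <= b -> newton_at g x1 y1 t)
  (sol2 : forall t, a <= t <= b -> newton_at g x2 y2 t).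

(* Gronwall: [|E'| <= (1 + L) E], so [E] times an exponential is monotone in
   either direction of time. *)
Let E t := (x1 t - x2 t) ^+ 2 + (y1 t - y2 t) ^+ 2.
Let dE t := 2 * (x1 t - x2 t) * (y1 t - y2 t) +
  2 * (y1 t - y2 t) * (g (x1 t) - g (x2 t)).

Let is_dE (t : R) : a <= t <= b -> is_derive t 1 E (dE t).
Proof.
move=> ab; have [dx1 dy1] := sol1 ab; have [dx2 dy2] := sol2 ab.
have -> : E = (x1 - x2) * (x1 - x2) + (y1 - y2) * (y1 - y2).
  by apply/funext => s; rewrite !fctE /E /=; ring.
by apply: is_derive_eq; rewrite /GRing.scale/= /dE !fctE/=; ring.
Qed.

Let dE_bound t : `|dE t| <= (1 + L) * E t.
Proof.
have L0 : 0 <= L := lipschitz_ge0 gL.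
rewrite /dE /E; have := gL (x1 t) (x2 t).
move: (x1 t - x2 t) (y1 t - y2 t) (g _ - g _) => u v h hL.
have -> : 2 * u * v + 2 * v * h = 2 * (v * (u + h)) by ring.
rewrite normrM (ger0_norm (_ : 0 <= 2)) ; last by [].
rewrite normrM.
have : `|u + h| <= (1 + L) * `|u|.
  by apply: le_trans (ler_normD _ _) _; rewrite mulrDl mul1r lerD2l.
rewrite -(real_normK (num_real u)) -(real_normK (num_real v)).
have := normr_ge0 u; have := normr_ge0 v; move: `|u| `|v| `|u + h| => p q r q0 p0 rp.
have : q * r <= q * ((1 + L) * p) by rewrite ler_wpM2l.
have : 0 <= (1 + L) * (p - q) ^+ 2 by rewrite mulr_ge0 ?sqr_ge0//; lra.
by lra.
Qed.

Let is_dE_exp (k t : R) : a <= t <= b ->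
  is_derive t 1 (fun t => E t * expR (k * t)) ((dE t + k * E t) * expR (k * t)).
Proof.
move=> ab; have d1 := is_dE ab.
have := @is_derive1_affine_comp _ expR k 0 t _ (is_derive_expR _).
rewrite addr0; under eq_fun do rewrite addr0.
move=> d2; have -> : (fun t => E t * expR (k * t)) = E * (fun t => expR (k * t)) by [].
by apply: is_derive_eq; rewrite /GRing.scale/=; ring.
Qed.

Lemma newton_unique s : a <= s <= b -> x1 s = x2 s -> y1 s = y2 s ->
  forall t, a <= t <= b -> x1 t = x2 t /\ y1 t = y2 t.
Proof.
move=> sab xs ys t tab.
have Es : E s = 0 by rewrite /E xs ys !subrr expr0n addr0.
suff Et : E t <= 0.
  have : (x1 t - x2 t) ^+ 2 + (y1 t - y2 t) ^+ 2 = 0.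
    by apply/eqP; rewrite eq_le Et/= addr_ge0 ?sqr_ge0.
  move/eqP; rewrite paddr_eq0 ?sqr_ge0// !sqrf_eq0 !subr_eq0.
  by move=> /andP[/eqP -> /eqP ->].
move: sab tab => /andP[as_ sb] /andP[at_ tb].
have [st|/ltW ts] := leP s t.
  have : - (E s * expR (- (1 + L) * s)) <= - (E t * expR (- (1 + L) * t)).
    apply: (@is_derive1_ge0_le _ (fun t => - (E t * expR (- (1 + L) * t))) (fun t => - ((dE t + - (1 + L) * E t) * expR (- (1 + L) * t)))) => //.
    - move=> r /andP[sr rt]; apply: is_deriveN; apply: is_dE_exp.
      by rewrite (le_trans as_ sr) (le_trans rt tb).
    - move=> r _; rewrite -mulNr mulr_ge0 ?expR_ge0//.
      by have := dE_bound r; rewrite ler_norml => /andP[_]; lra.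
  by rewrite Es mul0r oppr0 oppr_ge0 pmulr_lle0 ?expR_gt0.
have : E t * expR ((1 + L) * t) <= E s * expR ((1 + L) * s).
  apply: (@is_derive1_ge0_le _ (fun t => E t * expR ((1 + L) * t)) (fun t => ((dE t + (1 + L) * E t) * expR ((1 + L) * t)))) => //.
  - move=> r /andP[sr rt]; apply: is_dE_exp.
    by rewrite (le_trans at_ sr) (le_trans rt sb).
  - move=> r _; rewrite mulr_ge0 ?expR_ge0//.
    by have := dE_bound r; rewrite ler_norml => /andP[+ _]; lra.
by rewrite Es mul0r pmulr_lle0 ?expR_gt0.
Qed.

End Uniqueness.

Lemma newton_unique_global (g : R -> R) (L : R) (x1 y1 x2 y2 : R -> R) (s : R) :
  (forall x y, `|g x - g y| <= L * `|x - y|) ->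
  newton_solution g x1 y1 -> newton_solution g x2 y2 ->
  x1 s = x2 s -> y1 s = y2 s -> forall t, x1 t = x2 t /\ y1 t = y2 t.
Proof.
move=> gL s1 s2 xs ys t.
apply: (@newton_unique g L gL x1 y1 x2 y2 (Num.min s t) (Num.max s t)
  (fun r _ => s1 r) (fun r _ => s2 r) s _ xs ys).
  by rewrite ge_min le_max lexx.
by rewrite ge_min le_max lexx !orbT.
Qed.

Lemma newton_energy_cst (g G x y : R -> R) (a b : R) :
  (forall z : R, is_derive z 1 G (g z)) ->
  (forall t, a <= t <= b -> newton_at g x y t) ->
  forall s t, a <= s <= b -> a <= t <= b ->
  y s ^+ 2 / 2 - G (x s) = y t ^+ 2 / 2 - G (x t).
Proof.
move=> dG sol s t sab tab.
apply: (@is_derive1_eq0_cst _ (fun t => y t ^+ 2 / 2 - G (x t)) a b) => // r rab.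
exact: newton_energy (sol r rab).
Qed.

Lemma newton_energy_global (g G x y : R -> R) :
  (forall z : R, is_derive z 1 G (g z)) -> newton_solution g x y ->
  forall s t, y s ^+ 2 / 2 - G (x s) = y t ^+ 2 / 2 - G (x t).
Proof.
move=> dG sol s t.
apply: (@newton_energy_cst g G x y (Num.min s t) (Num.max s t) dG) => //.
  by rewrite ge_min le_max lexx.
by rewrite ge_min le_max lexx !orbT.
Qed.

End NewtonDynamics.

(** * Planar vector fields and energy levels *)

Section PlaneVectors.
Context {R : realType}.
Local Notation plane := 'rV[R]_2.

Lemma vec2E0 (x y : R) : vec2 x y ord0 0 = x. Proof. by rewrite mxE. Qed.
Lemma vec2E1 (x y : R) : vec2 x y ord0 1 = y. Proof. by rewrite mxE. Qed.

Lemma ord2_cases (j : 'I_2) : j = 0 \/ j = 1.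
Proof.
by case: j => [[|[|//]] jlt]; [left|right]; apply: val_inj.
Qed.

Lemma row2P (p q : plane) : p ord0 0 = q ord0 0 -> p ord0 1 = q ord0 1 -> p = q.
Proof. by move=> h0 h1; apply/rowP => j; have [->|->] := ord2_cases j. Qed.

Lemma vec2_eta (p : plane) : vec2 (p ord0 0) (p ord0 1) = p.
Proof. by apply: row2P; rewrite ?vec2E0 ?vec2E1. Qed.

Lemma cvg_row2 {T : Type} (F : set_system T) {FF : Filter F} (f : T -> plane) (p : plane) :
  f t ord0 0 @[t --> F] --> p ord0 0 -> f t ord0 1 @[t --> F] --> p ord0 1 ->
  f t @[t --> F] --> p.
Proof.
move=> h0 h1; apply/cvgrPdist_le => e e0; near=> t.
rewrite /Num.Def.normr/= mx_normrE; apply: bigmax_le; first exact: ltW.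
move=> [i j] _ /=; rewrite !mxE (ord1 i).
by have [->|->] := ord2_cases j; near: t; apply: cvgr_dist_le.
Unshelve. all: by end_near. Qed.

Lemma cvg_vec2 {T : Type} (F : set_system T) {FF : Filter F} (u v : T -> R) (x y : R) :
  u t @[t --> F] --> x -> v t @[t --> F] --> y ->
  vec2 (u t) (v t) @[t --> F] --> vec2 x y.
Proof.
move=> ux vy; apply: cvg_row2.
  by rewrite vec2E0; under eq_fun do rewrite vec2E0.
by rewrite vec2E1; under eq_fun do rewrite vec2E1.
Qed.

Lemma continuous_vec2 {T : topologicalType} (u v : T -> R) (t : T) :
  {for t, continuous u} -> {for t, continuous v} ->
  {for t, continuous (fun s => vec2 (u s) (v s))}.
Proof. exact: (@cvg_vec2 T (nbhs t)). Qed.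

Lemma is_derive_row2 (c : R -> plane) (t : R) (v : plane) :
  is_derive t 1 c v <-> is_derive t 1 (fun s => c s ord0 0) (v ord0 0) /\
    is_derive t 1 (fun s => c s ord0 1) (v ord0 1).
Proof.
split=> [[dc <-]|[[d0 e0] [d1 e1]]].
  have dcij := (derivable_mxP _ _ _).1 dc.
  by rewrite (derive_mx dc) !mxE; split; apply: DeriveDef => //; apply: dcij.
have dc : derivable c t 1.
  apply/derivable_mxP => i j; rewrite (ord1 i).
  by have [->|->] := ord2_cases j; [exact: d0|exact: d1].
by apply: (DeriveDef dc); rewrite (derive_mx dc); apply: row2P; rewrite !mxE.
Qed.

(** [afm_field b1 b2 a] is convertible to this field for [g x = afm_m b1 b2 x + a]. *)
Definition newton_field (g : R -> R) (p : plane) : plane :=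
  vec2 (p ord0 1) (g (p ord0 0)).

Lemma newton_field_solution (g : R -> R) (D : set plane) (I : set R) (c : R -> plane) :
  is_solution (newton_field g) D I c <-> forall t, I t ->
  D (c t) /\ newton_at g (fun s => c s ord0 0) (fun s => c s ord0 1) t.
Proof.
have E t := is_derive_row2 c t (newton_field g (c t)).
rewrite /newton_field in E *; setoid_rewrite vec2E0 in E; setoid_rewrite vec2E1 in E.
by split=> h t It; have [Dc] := h t It; rewrite ?E => H; split; rewrite ?E.
Qed.

End PlaneVectors.

(** * Truncation of the force to a segment *)

Section Truncation.
Context {R : realType}.
Variables (c d : R).
Hypothesis cd : c <= d.

(* Composing with [clamp c d] makes a function that is Lipschitz on [[c, d]]
   globally Lipschitz. *)
Definition clamp (x : R) : R := Num.max c (Num.min x d).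

Lemma clampE x : c <= x <= d -> clamp x = x.
Proof. by move=> /andP[cx xd]; rewrite /clamp min_l// max_r. Qed.

Lemma clamp_itv x : c <= clamp x <= d.
Proof. by rewrite /clamp le_max lexx/= ge_max cd ge_min lexx orbT. Qed.

Lemma clamp_lipschitz x y : `|clamp x - clamp y| <= `|x - y|.
Proof.
rewrite /clamp; have := ler_norm (x - y); have := ler_norm (y - x).
rewrite (distrC y); move: `|x - y| => e ? ?.
case: (leP x d) => ?; case: (leP y d) => ?; do 2?[case: (leP c _) => ?];
  by rewrite ler_norml; apply/andP; split; lra.
Qed.

(** With [clamp_gt], this keeps an argument on its side of [x0], so that signs of [f] on [[c, d]]
    become signs of the truncated force on the whole line. *)
Lemma clamp_lt x z : c < z -> x < z -> clamp x < z.
Proof. by move=> cz xz; rewrite /clamp gt_max cz gt_min xz. Qed.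

Lemma clamp_gt x z : z < d -> z < x -> z < clamp x.
Proof. by move=> zd zx; rewrite /clamp lt_max lt_min zx zd orbT. Qed.

End Truncation.

(** * Energy and its level sets *)

Section LevelSets.
Context {R : realType}.
Local Notation plane := 'rV[R]_2.

Definition energy (G : R -> R) (q : plane) : R :=
  (q ord0 1) ^+ 2 / 2 - G (q ord0 0).

Lemma continuous_energy (G : R -> R) : continuous G -> continuous (energy G).
Proof.
move=> cG q.
have c0 : {for q, continuous (fun M : plane => M ord0 0)} by exact: coord_continuous.
have c1 : {for q, continuous (fun M : plane => M ord0 1)} by exact: coord_continuous.
have cG0 : {for q, continuous (fun M : plane => G (M ord0 0))}.
  exact: (continuous_comp c0 (cG _)).
have c12 : {for q, continuous (fun M : plane => 2^-1 * (M ord0 1 * M ord0 1))}.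
  exact: (continuousM (@cst_continuous _ R 2^-1 q) (continuousM c1 c1)).
have -> : energy G = (fun M : plane => 2^-1 * (M ord0 1 * M ord0 1)) - (fun M : plane => G (M ord0 0)).
  by apply/funext => M; rewrite /energy mulrC expr2.
exact: continuousB.
Qed.

(** On the component of [p] in the complement, [H] omits the value [E] and starts below it, so by
    connectedness it stays below: the component lies in the bounded sublevel set. *)
Lemma surrounds_level (H : plane -> R) (E : R) (p : plane) : continuous H ->
  H p < E -> bounded_set [set q | H q <= E] ->
  surrounds [set q | H q = E] p.
Proof.
move=> cH HpE bE; split; first by move=> /= HpE'; rewrite HpE' ltxx in HpE.
set C := connected_component _ _.
have Cp : C p by apply: connected_component_refl => /= HpE'; rewrite HpE' ltxx in HpE.
have CE : C `<=` [set q | H q <= E].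
  move=> q Cq /=; rewrite leNgt; apply/negP => EHq.
  have /connected_intervalP iHC : connected [set H x | x in C].
    apply: connected_continuous_connected; first exact: component_connected.
    exact/continuous_subspaceT.
  have HpC : [set H x | x in C] (H p) by exists p.
  have HqC : [set H x | x in C] (H q) by exists q.
  have [|r Cr HrE] := iHC (H p) (H q) HpC HqC E.
    by rewrite (ltW HpE) (ltW EHq).
  by have /= := connected_component_sub Cr.
by case: bE => M [Mr bM]; exists M; split=> // N MN q /CE; exact: bM.
Qed.

End LevelSets.

(** * Non-linear centers *)

Section Center.
Context {R : realType}.

(* Otherwise [x] increases for ever: once beyond [x0] the velocity decreases at
   a definite rate, and before [x0] the velocity does not decrease, so that [x]
   would leave the half-line. *)
Lemma newton_velocity_le0 (g x y : R -> R) (x0 d s : R) :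
  continuous g -> (forall z, z <= x0 -> 0 <= g z) -> (forall z, x0 < z -> g z < 0) ->
  newton_solution g x y -> (forall t, x t < d) -> exists2 t, s <= t & y t <= 0.
Proof.
move=> cg gge0 glt0 sol xd; apply: contrapT => noty.
have y0 t : s <= t -> 0 < y t.
  by move=> st; rewrite ltNge; apply/negP => yt; apply: noty; exists t.
have [[t0 st0 xt0]|nox] := pselect (exists2 t, s <= t & x0 < x t).
  have [|k] := @EVT_max R g (x t0) d (ltW (xd t0)).
    exact: continuous_subspaceT.
  rewrite in_itv/= => /andP[xk kd] gk.
  have gk0 : g k < 0 by apply: glt0; exact: lt_le_trans xt0 xk.
  (* The time by which a deceleration of at least [- g k] has used up the velocity [y t0]; [g k] is
     the maximum of [g] over [[x t0, d]]. *)
  pose t1 := t0 - y t0 / g k.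
  have yt0 := y0 _ st0.
  have t01 : t0 <= t1.
    by rewrite /t1 lerDl oppr_ge0 pmulr_rle0// invr_le0 ltW.
  have [r /andP[t0r rt1] yE] := @is_derive1_MVT R y (fun t => g (x t)) t0 t1 t01
    (fun t _ => (sol t).2).
  have gr : g (x r) <= g k.
    apply: gk; rewrite in_itv/= (ltW (xd r)) andbT.
    apply: (@is_derive1_ge0_le R x y t0 r t0r (fun t _ => (sol t).1)) => t /andP[t0t _].
    by apply/ltW/y0; exact: le_trans t0t.
  have : y t1 <= 0.
    have : g (x r) * (t1 - t0) <= g k * (t1 - t0) by rewrite ler_wpM2r// subr_ge0.
    have -> : g k * (t1 - t0) = - y t0 by rewrite /t1; field; rewrite lt_eqF.
    by lra.
  by rewrite leNgt y0// (le_trans st0).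
have xx0 t : s <= t -> x t <= x0.
  by move=> st; rewrite leNgt; apply/negP => xt; apply: nox; exists t.
have ys := y0 s (lexx s).
pose t1 := s + (d - x s) / y s.
have st1 : s <= t1.
  by rewrite /t1 lerDl; apply: divr_ge0; [rewrite subr_ge0 ltW|exact: ltW].
have [r /andP[sr rt1] xE] := @is_derive1_MVT R x y s t1 st1 (fun t _ => (sol t).1).
have yr : y s <= y r.
  apply: (@is_derive1_ge0_le R y (fun t => g (x t)) s r sr (fun t _ => (sol t).2)) => t.
  by move=> /andP[st _]; apply/gge0/xx0.
have : y s * (t1 - s) <= y r * (t1 - s) by rewrite ler_wpM2r// subr_ge0.
have -> : y s * (t1 - s) = d - x s by rewrite /t1; field; rewrite gt_eqF.
by have := xd t1; lra.
Qed.

(** The velocity vanishes where [x] is maximal over a period. If that maximum were not beyond [x0],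
    the force would be positive throughout the period and [y] would increase strictly, against
    periodicity. *)
Lemma newton_turning_gt (g x y : R -> R) (x0 T : R) :
  (forall z, z < x0 -> 0 < g z) -> newton_solution g x y -> 0 < T ->
  (forall t, x (t + T) = x t) -> (forall t, y (t + T) = y t) ->
  (forall t, y t = 0 -> x t != x0) ->
  exists r, [/\ y r = 0, x0 < x r & forall t, 0 <= t <= T -> x t <= x r].
Proof.
move=> gpos sol T0 xT yT yx.
have cx : continuous x by move=> t; exact: is_derive1_continuous (sol t).1.
have [|r] := @EVT_max R x 0 T (ltW T0); first exact: continuous_subspaceT.
rewrite in_itv/= => /andP[r0 rT] rmax.
(* By periodicity the maximum over [[0, T]] is one over a larger open interval, hence interior even
   when [r] is an endpoint. *)
have rmax' t : - T < t < T + T -> x t <= x r.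
  move=> /andP[t1 t2]; have [t0|t0] := ltP t 0.
    by rewrite -xT; apply: rmax; rewrite in_itv/=; lra.
  have [tT|tT] := leP t T; first by apply: rmax; rewrite in_itv/= t0.
  by rewrite -(subrK T t) xT; apply: rmax; rewrite in_itv/=; lra.
have yr : y r = 0.
  have [_ <-] := (sol r).1.
  have [||||_ ->//] := @derive1_at_max R x (- T) (T + T) r.
  - lra.
  - by move=> t _; have [[]] := sol t.
  - by rewrite in_itv/=; lra.
  - by move=> t; rewrite in_itv/=; exact: rmax'.
exists r; split => //.
rewrite lt_neqAle eq_sym (yx r yr)/= leNgt; apply/negP => xr.
have : y 0 < y T.
  apply: (@is_derive1_gt0_lt R y (fun t => g (x t)) 0 T T0 (fun t _ => (sol t).2)).
  move=> t /andP[t0 tT]; apply: gpos; apply: le_lt_trans xr.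
  by apply: rmax; rewrite in_itv/= (ltW t0) (ltW tT).
by rewrite -[in y T](add0r T) yT ltxx.
Qed.

Lemma newton_flip_solution (g x y : R -> R) : newton_solution g x y ->
  newton_solution (fun z => - g (- z)) (fun s => - x s) (fun s => - y s).
Proof. by move=> sol t; exact: newton_flip. Qed.

End Center.

(** * Periodic orbits in a potential well *)

Section PotentialWell.
Context {R : realType}.
Variables (g G : R -> R) (L c x0 d : R).
Hypotheses (gL : forall x y : R, `|g x - g y| <= L * `|x - y|)
  (dG : forall z : R, is_derive z 1 G (g z))
  (cx0 : c < x0) (x0d : x0 < d) (g0 : g x0 = 0)
  (gpos : forall z, z < x0 -> 0 < g z) (gneg : forall z, x0 < z -> g z < 0).

Let cg : continuous g. Proof. exact: lipschitz_cts gL. Qed.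
Let cG : continuous G. Proof. by move=> z; exact: is_derive1_continuous (dG z). Qed.

Let G_incr u v : u < v -> v <= x0 -> G u < G v.
Proof.
move=> uv vx; apply: (@is_derive1_gt0_lt _ G g) => // t /andP[_ tv].
by apply: gpos; exact: lt_le_trans vx.
Qed.

Let G_decr u v : x0 <= u -> u < v -> G v < G u.
Proof.
move=> xu uv; rewrite -ltrN2.
apply: (@is_derive1_gt0_lt _ (fun t => - G t) (fun t => - g t)) => // t /andP[ut _].
by rewrite oppr_gt0; apply: gneg; exact: le_lt_trans ut.
Qed.

Let G_max u : G u <= G x0.
Proof.
have [h|h|->//] := ltgtP u x0; first exact/ltW/G_incr.
exact/ltW/G_decr.
Qed.

Let G_max_eq u : G u = G x0 -> u = x0.
Proof.
have [h|h|//] := ltgtP u x0 => e.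
  by have := G_incr h (lexx _); rewrite e ltxx.
by have := G_decr (lexx _) h; rewrite e ltxx.
Qed.

(** The potential is [- G]; this is the height of the lower of the two rims at [c] and [d]. *)
Let E0 := Num.min (- G c) (- G d).

Lemma well_itv u v : v ^+ 2 / 2 - G u < E0 -> c < u < d.
Proof.
rewrite /E0 lt_min => /andP[h1 h2].
have v0 : 0 <= v ^+ 2 / 2 by rewrite divr_ge0 ?sqr_ge0.
apply/andP; split; rewrite ltNge; apply/negP => h.
  have : G u <= G c.
    by move: h; rewrite le_eqVlt => /orP[/eqP->//|h]; apply/ltW/G_incr => //; exact: ltW.
  lra.
have : G u <= G d.
  by move: h; rewrite le_eqVlt => /orP[/eqP->//|h]; apply/ltW/G_decr => //; exact: ltW.
lra.
Qed.

Lemma well_bottom : - G x0 < E0.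
Proof.
by rewrite /E0 lt_min !ltrN2 G_incr// G_decr.
Qed.

(** Only boundedness matters, so the crude [w <= 1 + w ^+ 2] stands in for a square root. *)
Lemma well_speed u v : v ^+ 2 / 2 - G u < E0 -> `|v| <= 1 + 2 * (E0 + G x0).
Proof.
move=> h; have := G_max u; have := real_normK (num_real v).
by move: (normr_ge0 v); move: `|v| => w w0 e Gu; nra.
Qed.

Section Orbit.
Variables (x y : R -> R).
Hypotheses (sol : newton_solution g x y)
  (E_top : (y 0) ^+ 2 / 2 - G (x 0) < E0)
  (nonequilibrium : x 0 != x0 \/ y 0 != 0).

Let E := (y 0) ^+ 2 / 2 - G (x 0).

Let energyE t : (y t) ^+ 2 / 2 - G (x t) = E.
Proof. exact: (newton_energy_global dG sol). Qed.

Lemma orbit_itv t : c < x t < d.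
Proof. by apply: (@well_itv _ (y t)); rewrite energyE. Qed.

Lemma orbit_above_bottom : - G x0 < E.
Proof.
have y0 : 0 <= y 0 ^+ 2 by exact: sqr_ge0.
have xm := G_max (x 0).
rewrite lt_neqAle; apply/andP; split; last by rewrite /E; lra.
apply/eqP => e; rewrite /E in e.
have /G_max_eq ex : G (x 0) = G x0 by lra.
have : y 0 ^+ 2 == 0 by apply/eqP; rewrite ex in e; lra.
rewrite sqrf_eq0 => /eqP ey.
by case: nonequilibrium; rewrite ?ex ?ey eqxx.
Qed.

(** After any time the velocity is somewhere nonpositive and, by the flipped equation, later
    somewhere nonnegative; the zero lies between. *)
Let y_zero s : exists2 t, s <= t & y t = 0.
Proof.
have [t st yt] : exists2 t, s <= t & y t <= 0.
  apply: (@newton_velocity_le0 _ g x y x0 d) => //.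
    by move=> z; rewrite le_eqVlt => /orP[/eqP->|/gpos/ltW//]; rewrite g0.
  by move=> t; case/andP: (orbit_itv t).
have [t' tt' yt'] : exists2 t', t <= t' & - y t' <= 0.
  apply: (@newton_velocity_le0 _ (fun z => - g (- z)) (fun t => - x t)
    (fun t => - y t) (- x0) (- c)).
  - move=> z; apply: continuousN; apply: continuous_comp; last exact: cg.
    exact: opp_continuous.
  - move=> z; rewrite lerNr le_eqVlt oppr_ge0 => /orP[/eqP<-|/gneg/ltW//].
    by rewrite g0.
  - by move=> z; rewrite ltrNl oppr_lt0; exact: gpos.
  - exact: newton_flip_solution.
  - by move=> r; rewrite ltrN2; case/andP: (orbit_itv r).
have [||r] := @IVT R y t t' 0 tt'.
- by apply: continuous_subspaceT => r; exact: is_derive1_continuous (sol r).2.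
- by rewrite oppr_le0 in yt'; rewrite ge_min le_max yt yt' orbT.
rewrite in_itv/= => /andP[tr _] yr; exists r => //; exact: le_trans st tr.
Qed.

(** The orbit and its time reversal about [r] have the same data at [r], because [y r = 0] equals
    its own opposite. *)
Let reflect r : y r = 0 -> forall s, x (r + s) = x (r - s) /\ y (r + s) = - y (r - s).
Proof.
move=> yr s.
have sol' : newton_solution g (fun t => x (r + r - t)) (fun t => - y (r + r - t)).
  by move=> t; exact: newton_reverse.
have [||] := newton_unique_global gL sol sol' (s := r) _ _ (r + s).
- by rewrite addrK.
- by rewrite addrK yr oppr0.
by rewrite opprD addrACA subrr add0r addrC => -> ->.
Qed.

Lemma orbit_level_set :
  exists T, [/\ 0 < T, forall t, x (t + T) = x t, forall t, y (t + T) = y t &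
    forall u v, v ^+ 2 / 2 - G u = E -> exists t, x t = u /\ y t = v].
Proof.
have [t1 _ y1] := y_zero 0.
(* The shift by [1] forces [t1 < t2], hence a positive period. *)
have [t2 t12 y2] := y_zero (t1 + 1).
pose T := 2 * (t2 - t1).
have T0 : 0 < T by rewrite /T; lra.
have per t : x (t + T) = x t /\ y (t + T) = y t.
  (* The composite of the time reflections about [t2] and [t1] is the translation by [T]. *)
  have -> : t + T = t2 + (t + T - t2) by ring.
  have [-> ->] := reflect y2 (t + T - t2).
  have -> : t2 - (t + T - t2) = t1 + (t1 - t) by rewrite /T; ring.
  have [-> ->] := reflect y1 (t1 - t).
  by rewrite opprK; split; congr (_ _); ring.
have xT t : x (t + T) = x t by have [] := per t.
have yT t : y (t + T) = y t by have [] := per t.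
exists T; split => // u v uvE.
have yx t : y t = 0 -> x t != x0.
  move=> yt; apply/eqP => xt; have := energyE t; rewrite yt xt expr0n/= mul0r sub0r.
  by move=> h; move: orbit_above_bottom; rewrite h ltxx.
have [rM [yM xM maxM]] := @newton_turning_gt _ g x y x0 T gpos sol T0 xT yT yx.
have [||||||rm [ym xm maxm]] := @newton_turning_gt _ (fun z => - g (- z)) (fun t => - x t)
  (fun t => - y t) (- x0) T.
- by move=> z; rewrite ltrNr oppr_gt0; exact: gneg.
- exact: newton_flip_solution.
- by [].
- by move=> t; rewrite xT.
- by move=> t; rewrite yT.
- by move=> t /eqP; rewrite oppr_eq0 => /eqP/yx; rewrite (inj_eq oppr_inj).
rewrite ltrN2 in xm; move/eqP: ym; rewrite oppr_eq0 => /eqP ym.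
have GM : - G (x rM) = E by rewrite -(energyE rM) yM expr0n/= mul0r sub0r.
have Gm : - G (x rm) = E by rewrite -(energyE rm) ym expr0n/= mul0r sub0r.
have v0 : 0 <= v ^+ 2 by exact: sqr_ge0.
have uM : u <= x rM.
  by rewrite leNgt; apply/negP => h; have := G_decr (ltW xM) h; lra.
have um : x rm <= u.
  by rewrite leNgt; apply/negP => h; have := G_incr h (ltW xm); lra.
(* The level lies over the segment between the two turning points, which [x] sweeps. Energy then
   gives [y t = v] or [y t = - v], and reflection about [t1] exchanges the two. *)
have [t xt] : exists t, x t = u.
  have cx : continuous x by move=> t; exact: is_derive1_continuous (sol t).1.
  have [rr|rr] := leP rm rM.
    have [||t _ <-] := @IVT R x rm rM u rr; last by exists t.
      exact: continuous_subspaceT.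
    by rewrite ge_min le_max um uM orbT.
  have [||t _ <-] := @IVT R x rM rm u (ltW rr); last by exists t.
    exact: continuous_subspaceT.
  by rewrite ge_min le_max um uM orbT.
have : y t ^+ 2 == v ^+ 2 by apply/eqP; have := energyE t; rewrite xt; lra.
rewrite eqf_sqr => /orP[/eqP yt|/eqP yt]; first by exists t.
exists (t1 - (t - t1)); have [e1 e2] := reflect y1 (t - t1).
rewrite -e1; have -> : t1 + (t - t1) = t by ring.
split=> //; apply: oppr_inj; rewrite -e2 -yt; congr (y _); ring.
Qed.

End Orbit.

End PotentialWell.

(** * The criterion for a non-linear center *)

Section CenterTheorem.
Context {R : realType}.
Local Notation plane := 'rV[R]_2.

Lemma bounded_row2 (A : set plane) (M : R) :
  (forall q, A q -> `|q ord0 0| <= M /\ `|q ord0 1| <= M) -> bounded_set A.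
Proof.
move=> AM; exists M; split=> [|N MN q Aq]; first exact: num_real.
have [h0 h1] := AM q Aq.
rewrite /= /Num.Def.normr/= mx_normrE.
apply: bigmax_le; first by apply: le_trans (ltW MN); apply: le_trans h0.
move=> [i j] _ /=; rewrite (ord1 i); apply: le_trans (ltW MN).
by have [->|->] := ord2_cases j.
Qed.

Lemma clamp_comp_lipschitz (f : R -> R) (L c d : R) : c <= d -> 0 <= L ->
  (forall x y, c <= x <= d -> c <= y <= d -> `|f x - f y| <= L * `|x - y|) ->
  forall x y, `|f (clamp c d x) - f (clamp c d y)| <= L * `|x - y|.
Proof.
move=> cd L0 fL x y; apply: le_trans (fL _ _ (clamp_itv cd _) (clamp_itv cd _)) _.
by apply: ler_wpM2l => //; exact: clamp_lipschitz.
Qed.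

Lemma newton_field_equilibria (f : R -> R) (D : set plane) (p : plane) :
  equilibria (newton_field f) D p <-> [/\ D p, f (p ord0 0) = 0 & p ord0 1 = 0].
Proof.
rewrite /equilibria /newton_field /=; split=> [[Dp /rowP e]|[Dp f0 y0]].
  have := e 0; have := e 1; rewrite !mxE/= => ? ?; split => //.
by split => //; rewrite f0 y0; apply: row2P; rewrite ?vec2E0 ?vec2E1 mxE.
Qed.

(** The neighborhood is the energy sublevel set below both rims. Orbits of the truncated force in it
    stay over []c, d[], so they solve the original equation, and each fills its whole level. *)
Theorem newton_nonlinear_center (f : R -> R) (D : set plane) (L c x0 d : R) :
  c < x0 -> x0 < d -> 0 <= L ->
  (forall x y, c <= x <= d -> c <= y <= d -> `|f x - f y| <= L * `|x - y|) ->
  f x0 = 0 ->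
  (forall x, c <= x -> x < x0 -> 0 < f x) ->
  (forall x, x0 < x -> x <= d -> f x < 0) ->
  (forall p : plane, c < p ord0 0 < d -> D p) ->
  nonlinear_center (newton_field f) D (vec2 x0 0).
Proof.
move=> cx0 x0d L0 fL f0 fpos fneg DS.
have cd : c <= d by apply/ltW/(lt_trans cx0).
pose g x := f (clamp c d x).
have gL : forall x y, `|g x - g y| <= L * `|x - y| := clamp_comp_lipschitz cd L0 fL.
have fg x : c <= x <= d -> f x = g x by move=> h; rewrite /g clampE.
have g0 : g x0 = 0 by rewrite -fg ?f0// (ltW cx0) ltW.
have gpos x : x < x0 -> 0 < g x.
  by move=> h; apply: fpos; [case/andP: (clamp_itv cd x)|exact: clamp_lt].
have gneg x : x0 < x -> g x < 0.
  by move=> h; apply: fneg; [exact: clamp_gt|case/andP: (clamp_itv cd x)].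
have [G [_ dG]] := primitive_exists (lipschitz_cts gL).
have cG : continuous G by move=> z; exact: is_derive1_continuous (dG z).
pose E0 := Num.min (- G c) (- G d).
have cH := continuous_energy cG.
have Hp : energy G (vec2 x0 0) = - G x0.
  by rewrite /energy vec2E0 vec2E1 expr0n/= mul0r sub0r.
have pE0 : energy G (vec2 x0 0) < E0.
  by rewrite Hp; exact: (well_bottom dG cx0 x0d gpos gneg).
split.
  by apply/newton_field_equilibria; rewrite vec2E0 vec2E1 f0; split => //; apply: DS; rewrite vec2E0 cx0.
exists [set q | energy G q < E0].
  by apply: (cvgr_lt _ (cH _)).
move=> q [/= qE0 qp].
have [x [y [sol x0q y0q]]] := newton_solution_exists gL (q ord0 0) (q ord0 1).
have Etop : (y 0) ^+ 2 / 2 - G (x 0) < E0 by rewrite x0q y0q.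
have noneq : x 0 != x0 \/ y 0 != 0.
  apply/orP; rewrite -negb_and; apply/negP => /andP[/eqP h0 /eqP h1]; apply: qp.
  by apply: row2P; rewrite ?vec2E0 ?vec2E1 -?x0q -?y0q.
have xcd := orbit_itv dG cx0 x0d gpos gneg sol Etop.
have Ebot := orbit_above_bottom dG gpos gneg noneq.
have [T [T0 xT yT lev]] := orbit_level_set gL dG cx0 x0d g0 gpos gneg sol Etop noneq.
pose gamma t : plane := vec2 (x t) (y t).
pose E := (y 0) ^+ 2 / 2 - G (x 0).
have gammaE : range gamma = [set q | energy G q = E].
  apply/seteqP; split => [_ [t _ <-]|r rE] /=.
    by rewrite /energy vec2E0 vec2E1; exact: newton_energy_global dG sol _ _.
  have [t [xt yt]] := lev _ _ rE.
  by exists t => //; rewrite /gamma xt yt vec2_eta.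
have gamma0 : gamma 0 = q by rewrite /gamma x0q y0q vec2_eta.
exists (range gamma); split.
- exists gamma, T; split => //.
  + apply/newton_field_solution => t _; split.
      by apply: DS; rewrite vec2E0.
    rewrite /gamma; under eq_fun do rewrite vec2E0; under [X in newton_at _ _ X]eq_fun do rewrite vec2E1.
    have [dx dy] := sol t; split => //.
    by rewrite fg//; have /andP[/ltW -> /ltW ->] := xcd t.
  + by move=> t; rewrite /gamma xT yT.
  (* A constant orbit would have zero velocity and zero force, so it would be the equilibrium. *)
  + apply: contrapT => gcst.
    have gc t : gamma t = gamma 0.
      by apply/eqP; apply: contrapT => h; apply: gcst; exists t; apply/negP.
    have xc t : x t = x 0 by have := congr1 (fun v : plane => v ord0 0) (gc t); rewrite !vec2E0.
    have yc t : y t = y 0 by have := congr1 (fun v : plane => v ord0 1) (gc t); rewrite !vec2E1.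
    have [[_ dx] [_ dy]] := sol 0.
    have y00 : y 0 = 0.
      by rewrite -dx (_ : x = cst (x 0)) ?derive_cst//; apply/funext => t; rewrite xc.
    have gx0 : g (x 0) = 0.
      by rewrite -dy (_ : y = cst (y 0)) ?derive_cst//; apply/funext => t; rewrite yc.
    case: noneq; rewrite ?y00 ?eqxx// => xx0.
    have [h|h|h] := ltgtP (x 0) x0; last by rewrite h eqxx in xx0.
      by have := gpos _ h; rewrite gx0 ltxx.
    by have := gneg _ h; rewrite gx0 ltxx.
- by exists 0.
- rewrite gammaE => r /= rE; split; first by rewrite /= rE.
  by move=> rp; move: rE; rewrite rp Hp => h; move: Ebot; rewrite -/E -h ltxx.
rewrite gammaE; apply: surrounds_level => //; first by rewrite Hp.
pose M := `|c| + `|d| + `|1 + 2 * (E0 + G x0)|.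
apply: (@bounded_row2 _ M) => r /= rE.
have rE0 : energy G r < E0 by exact: le_lt_trans Etop.
have /andP[cr rd] := well_itv dG cx0 x0d gpos gneg rE0.
have := well_speed dG gpos gneg rE0.
have := ler_norm (1 + 2 * (E0 + G x0)); rewrite /M.
have := normr_ge0 (1 + 2 * (E0 + G x0)); have := ler_norm d; have := ler_norm (- c).
have := normr_ge0 c; have := normr_ge0 d; rewrite normrN -/E0 => *; split; last by lra.
by rewrite ler_norml; apply/andP; split; lra.
Qed.

End CenterTheorem.

(** * Linearization and point reflection *)

Section Linearization.
Context {R : realType}.
Local Notation plane := 'rV[R]_2.

(** The Jacobian is described by its action on row vectors, the form in which eigenvectors and the
    kernel test for the determinant use it. *)
Lemma newton_field_diff (f : R -> R) (p : plane) (k : R) :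
  is_derive (p ord0 0) 1 f k ->
  differentiable (newton_field f) p /\
  forall v : plane, v *m 'J (newton_field f) p = vec2 (v ord0 1) (k * v ord0 0).
Proof.
move=> [df fk].
have c0 : continuous (fun M : plane => M ord0 0) by exact: coord_continuous.
have c1 : continuous (fun M : plane => M ord0 1) by exact: coord_continuous.
have l0 : linear (fun M : plane => M ord0 0) by move=> a u v; rewrite !mxE.
have l1 : linear (fun M : plane => M ord0 1) by move=> a u v; rewrite !mxE.
pose L0 : {linear plane -> R} := HB.pack (fun M : plane => M ord0 0) (GRing.isLinear.Build _ _ _ _ _ l0).
pose L1 : {linear plane -> R} := HB.pack (fun M : plane => M ord0 1) (GRing.isLinear.Build _ _ _ _ _ l1).
have dL0 : differentiable L0 p by apply: linear_differentiable; exact: c0.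
have dL1 : differentiable L1 p by apply: linear_differentiable; exact: c1.
have dfL : differentiable (f \o L0) p.
  by apply: differentiable_comp => //; exact/derivable1_diffP.
(* Splitting along the two basis vectors reduces differentiability to that of scalar functions of
   linear coordinates. *)
have E : newton_field f = (fun q => L1 q *: vec2 1 0) + (fun q => (f \o L0) q *: vec2 0 1).
  by apply/funext => q; apply: row2P; rewrite !fctE !mxE /= ; ring.
have d1 := @differentiableZl _ _ _ L1 (vec2 1 0) p dL1.
have d2 := @differentiableZl _ _ _ (f \o L0) (vec2 0 1) p dfL.
have dF : differentiable (newton_field f) p by rewrite E; exact: differentiableD.
split => // v.
rewrite -deriveEjacobian// derive_mx; last exact: diff_derivable.
apply: row2P; rewrite mxE.
  have -> : (fun q => newton_field f q ord0 0) = L1.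
    by apply/funext => q; rewrite vec2E0.
  by rewrite deriveE// diff_lin// vec2E0.
have -> : (fun q => newton_field f q ord0 1) = f \o L0.
  by apply/funext => q; rewrite vec2E1.
rewrite deriveE// vec2E1.
have H := @diff_comp _ _ _ _ L0 f p dL0.
rewrite H; last exact/derivable1_diffP.
have dl : 'd L0 p v = v ord0 0 by rewrite diff_lin.
rewrite -[LHS]/('d f (L0 p) ('d L0 p v)) dl deriv1E//.
by rewrite derive1E fk /GRing.scale/= mulrC.
Qed.

(** The characteristic equation is [lambda ^+ 2 = k], with left eigenvectors [vec2 1 lambda]. *)
Lemma newton_saddle (f : R -> R) (D : set plane) (x0 k : R) :
  0 < k -> is_derive x0 1 f k -> f x0 = 0 -> D (vec2 x0 0) ->
  saddle (newton_field f) D (vec2 x0 0).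
Proof.
move=> k0 df f0 Dp.
have [|dF JE] := @newton_field_diff f (vec2 x0 0) k; first by rewrite vec2E0.
have s0 : 0 < Num.sqrt k by rewrite sqrtr_gt0.
have ss : Num.sqrt k * Num.sqrt k = k by rewrite -expr2 sqr_sqrtr// ltW.
have vec1_neq0 (z : R) : vec2 1 z != 0.
  by apply/eqP => /rowP/(_ 0); rewrite !mxE/= => /eqP; rewrite oner_eq0.
split => //; first by apply/newton_field_equilibria; rewrite vec2E0 vec2E1.
exists (Num.sqrt k), (- Num.sqrt k); split => //; first by rewrite oppr_lt0.
  apply/eigenvalueP; exists (vec2 1 (Num.sqrt k)) => //.
  by rewrite JE; apply: row2P; rewrite !mxE/= ?ss; ring.
apply/eigenvalueP; exists (vec2 1 (- Num.sqrt k)) => //.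
by rewrite JE; apply: row2P; rewrite !mxE/= ?mulrNN ?ss; ring.
Qed.

Lemma newton_degenerate (f : R -> R) (x0 : R) :
  is_derive x0 1 f 0 -> degenerate (newton_field f) (vec2 x0 0).
Proof.
move=> df.
have [|dF JE] := @newton_field_diff f (vec2 x0 0) 0; first by rewrite vec2E0.
split => //; apply/eqP/det0P; exists (vec2 1 0).
  by apply/eqP => /rowP/(_ 0); rewrite !mxE/= => /eqP; rewrite oner_eq0.
by rewrite JE; apply: row2P; rewrite !mxE//= mul0r.
Qed.

End Linearization.

(** * Point reflection of fields, sectors and cusps *)

Section PointReflection.
Context {R : realType}.
Local Notation plane := 'rV[R]_2.
Implicit Types (F : plane -> plane) (D S : set plane).

(** The push-forward of [F] under the involution [q -> - q]. *)
Definition reflect_field F (q : plane) : plane := - F (- q).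
Definition reflect_set S : set plane := [set q | S (- q)].

Lemma reflect_setK S : reflect_set (reflect_set S) = S.
Proof. by apply/seteqP; split => q; rewrite /reflect_set /= opprK. Qed.

Lemma reflect_fieldK F : reflect_field (reflect_field F) = F.
Proof. by apply/funext => q; rewrite /reflect_field !opprK. Qed.

Lemma reflect_set_image T (c : T -> plane) (A : set T) :
  (fun t => - c t) @` A = reflect_set (c @` A).
Proof.
apply/seteqP; split => [_ [t At <-]|q [t At e]].
  by exists t; rewrite ?opprK.
by exists t => //; rewrite e opprK.
Qed.

Lemma reflect_solution F D I (c : R -> plane) :
  is_solution (reflect_field F) (reflect_set D) I c ->
  is_solution F D I (fun t => - c t).
Proof.
move=> h t It; have [Dc dc] := h t It; split => //.
by have := is_deriveN dc; rewrite /reflect_field opprK; exact.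
Qed.

Lemma reflect_reaches F S q q' :
  reaches (reflect_field F) (reflect_set S) q q' <-> reaches F S (- q) (- q').
Proof.
split=> [[T [c [T0 sol c0 cT]]]|[T [c [T0 sol c0 cT]]]].
  exists T, (fun t => - c t); split => //; first exact: reflect_solution.
    by rewrite c0.
  by rewrite cT.
exists T, (fun t => - c t); split => //.
- by apply: reflect_solution; rewrite reflect_fieldK reflect_setK.
- by rewrite c0 opprK.
- by rewrite cT opprK.
Qed.

Lemma reflect_hyperbolic_sector F p S si so :
  hyperbolic_sector (reflect_field F) (- p) (reflect_set S) si so ->
  hyperbolic_sector F p S (reflect_set si) (reflect_set so).
Proof.
move=> [h [[[hbij hcts [k kcts kK]] hreach] h0 hin hout]].
have [hS hinj hsurj] := hbij.
exists (fun q => - h q); split.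
- split; last by move=> q q' Aq Aq'; rewrite -reflect_reaches; exact: hreach.
  split.
  + split=> [q Aq|q q' Aq Aq' /oppr_inj|q Sq].
    * exact: hS.
    * exact: hinj.
    * have [|r Ar hr] := hsurj (- q); first by rewrite /reflect_set /= opprK.
      by exists r => //; rewrite hr opprK.
  + by move=> q; apply: cvgN; exact: hcts.
  + exists (fun q => k (- q)); last by move=> q Aq; rewrite opprK; exact: kK.
    apply/subspace_continuousP => q Sq.
    have Sq' : reflect_set S (- q) by rewrite /reflect_set /= opprK.
    move/subspace_continuousP : kcts => /(_ _ Sq') kcts.
    apply: (@cvg_comp _ _ _ (fun q => - q) k _ _ _ _ kcts) => P /= wP.
    have wP' : nbhs (- q) (fun z : plane => reflect_set S z -> P z) by exact: wP.
    have wPq : nbhs q (fun z : plane => reflect_set S (- z) -> P (- z)).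
      exact: (@opp_continuous _ q _ wP').
    apply: (@filterS _ (nbhs q) _ _ _ _ wPq) => z Pz Sz.
    by apply: Pz; rewrite /reflect_set /= opprK.
- by rewrite h0 opprK.
- by rewrite reflect_set_image hin.
- by rewrite reflect_set_image hout.
Qed.

Lemma nbhs_reflect (p : plane) (N : set plane) :
  nbhs (- p) (reflect_set N) -> nbhs p N.
Proof.
move=> h; have h' : nbhs p (fun q => reflect_set N (- q)) by exact: (@opp_continuous _ p _ h).
by apply: (@filterS _ (nbhs p) _ _ _ _ h') => q; rewrite /reflect_set /= opprK.
Qed.

(** Degeneracy is supplied for [F] itself; the rest is carried over by [q -> - q], which keeps the
    direction of time, so the incoming and outgoing separatrices keep their roles. *)
Lemma cusp_reflect F D p :
  cusp (reflect_field F) (reflect_set D) (- p) -> differentiable F p ->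
  \det ('J F p) = 0 -> cusp F D p.
Proof.
move=> [[[Dp Fp] isoF] _ [N [S1 [S2 [si [so]]]]]] + dF JF.
move=> [[nN ND] [[ci [soli cvi si_E]] [co [solo cvo so_E]]] [hs1 hs2] NE SE].
have E0 q : F q = 0 <-> reflect_field F (- q) = 0.
  rewrite /reflect_field opprK; split=> [->|/eqP]; first by rewrite oppr0.
  by rewrite oppr_eq0 => /eqP.
split.
- split; first by split; [move: Dp; rewrite /reflect_set /= opprK|exact: (E0 p).2 Fp].
  have isoF' : nbhs p (fun q => equilibria (reflect_field F) (reflect_set D) (- q) -> - q = - p).
    exact: (@opp_continuous _ p _ isoF).
  apply: (@filterS _ (nbhs p) _ _ _ _ isoF') => q isoq [Dq Fq].
  apply: oppr_inj; apply: isoq; split; first by rewrite /reflect_set /= opprK.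
  exact: (E0 q).1 Fq.
- by split.
exists (reflect_set N), (reflect_set S1), (reflect_set S2), (reflect_set si), (reflect_set so).
split.
- split; first by apply: nbhs_reflect; rewrite reflect_setK.
  by move=> q /ND; rewrite /reflect_set /= opprK.
- split.
    exists (fun t => - ci t); split; first exact: reflect_solution.
      by rewrite -(opprK p); exact: cvgN.
    by rewrite si_E reflect_set_image.
  exists (fun t => - co t); split; first exact: reflect_solution.
    by rewrite -(opprK p); exact: cvgN.
  by rewrite so_E reflect_set_image.
- by split; apply: reflect_hyperbolic_sector; rewrite reflect_setK.
- by rewrite NE.
- rewrite -[LHS]/(reflect_set (S1 `&` S2)) SE; apply/seteqP; split => q.
    by move=> [[/= /oppr_inj h|h]|h]; [left; left|left; right|right].
  by move=> [[/= ->|h]|h]; [left; left|left; right|right].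
Qed.

End PointReflection.

(** * Cusps *)

Section CuspDynamics.
Context {R : realType}.
Variables (g G : R -> R) (L x0 : R).
(** [gaway] makes positivity off [x0] uniform outside each ball, even at infinity, as truncation
    ensures; no orbit can then linger away from [x0] with a nearly constant velocity. *)
Hypotheses (gL : forall x y : R, `|g x - g y| <= L * `|x - y|)
  (dG : forall z : R, is_derive z 1 G (g z)) (G0 : G x0 = 0)
  (g0 : g x0 = 0)
  (gaway : forall e : R, 0 < e -> exists2 k : R, 0 < k & forall z, e <= `|z - x0| -> k <= g z).

Let gpos z : z != x0 -> 0 < g z.
Proof.
move=> zx; have [|k k0 kg] := gaway (e := `|z - x0|); first by rewrite normr_gt0 subr_eq0.
exact: lt_le_trans k0 (kg _ (lexx _)).
Qed.

Let gge0 z : 0 <= g z.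
Proof. by have [->|/gpos/ltW//] := eqVneq z x0; rewrite g0. Qed.

(** Splitting at [x0] bypasses the one point where the derivative vanishes. *)
Lemma cusp_primitive_lt u v : u < v -> G u < G v.
Proof.
have Glt a b : a < b -> (b <= x0) || (x0 <= a) -> G a < G b.
  move=> ab hx; apply: (@is_derive1_gt0_lt _ G g) => // t /andP[at_ tb].
  apply: gpos; case/orP: hx => h; first by rewrite lt_eqF// (lt_le_trans tb).
  by rewrite gt_eqF// (le_lt_trans h).
move=> uv; have [vx|xv] := leP v x0; first by apply: Glt => //; rewrite vx.
have [xu|ux] := leP x0 u; first by apply: Glt => //; rewrite xu orbT.
by apply: (@lt_trans _ _ (G x0)); apply: Glt => //; rewrite lexx ?orbT.
Qed.

Lemma cusp_primitive_inj u v : G u = G v -> u = v.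
Proof.
by have [/cusp_primitive_lt|/cusp_primitive_lt|//] := ltgtP u v => + e; rewrite e ltxx.
Qed.

Let cG : continuous G. Proof. by move=> z; exact: is_derive1_continuous (dG z). Qed.

(** On the zero level the velocity vanishes only over [x0], since [G] is injective; there the orbit
    is the rest solution by uniqueness. Any other orbit keeps the sign of its velocity. *)
Lemma cusp_no_crossing (x y : R -> R) (T : R) : 0 <= T ->
  (forall t, 0 <= t <= T -> newton_at g x y t) ->
  y 0 ^+ 2 / 2 - G (x 0) = 0 ->
  [\/ 0 < y 0, y T < 0 | y 0 = y T].
Proof.
move=> T0 sol H0.
have rest t : 0 <= t <= T -> y t = 0 -> y 0 = 0 /\ y T = 0.
  move=> tT yt.
  have xt : x t = x0.
    apply: cusp_primitive_inj; rewrite G0.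
    have := newton_energy_cst dG sol (_ : 0 <= 0 <= T) tT.
    by rewrite lexx T0 H0 yt expr0n/= mul0r sub0r => /(_ isT) /eqP; rewrite eq_sym oppr_eq0 => /eqP.
  have solc r : 0 <= r <= T -> newton_at g (fun=> x0) (fun=> 0) r.
    by move=> _; split; [exact: is_derive_cst|rewrite g0; exact: is_derive_cst].
  have uniq := newton_unique gL sol solc tT xt yt.
  by split; apply: (uniq _ _).2; rewrite lexx ?T0.
have [y0|y0|y0] := ltgtP (y 0) 0; last 2 first.
- by constructor 1.
- have [_ yT] := rest 0 (introT andP (conj (lexx _) T0)) y0.
  by constructor 3; rewrite y0 yT.
have [yT|yT] := ltP (y T) 0; first by constructor 2.
have [||t] := @IVT R y 0 T 0 T0.
- apply: (@is_derive1_within _ _ (fun t => g (x t))) => t tT; exact: (sol t tT).2.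
- by rewrite ge_min le_max yT (ltW y0) orbT.
by rewrite in_itv/= => tT /(rest t tT) [y00]; rewrite y00 ltxx in y0.
Qed.

(** * Orbits whose velocity stays bounded above tend to the equilibrium *)

Section Bounded.
Variables (x y : R -> R) (B : R).
Hypotheses (sol : newton_solution g x y) (yB : forall t : R, 0 <= t -> y t <= B).

Lemma cusp_velocity_ndecr s t : s <= t -> y s <= y t.
Proof.
move=> st; apply: (@is_derive1_ge0_le _ y (fun t => g (x t))) => // r _.
exact: (sol r).2.
Qed.

Let l := sup (range y).

Let yl : y t @[t --> +oo] --> l.
Proof.
apply: nondecreasing_cvgr; first exact: cusp_velocity_ndecr.
exists B => _ [t _ <-]; have [t0|/ltW t0] := leP 0 t; first exact: yB.
exact: le_trans (cusp_velocity_ndecr t0) (yB (lexx _)).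
Qed.

Let E := y 0 ^+ 2 / 2 - G (x 0).

Let xE t : G (x t) = y t ^+ 2 / 2 - E.
Proof. by have := newton_energy_global dG sol t 0; rewrite -/E => <-; ring. Qed.

Let Gl : G (x t) @[t --> +oo] --> l ^+ 2 / 2 - E.
Proof.
under eq_fun do rewrite xE.
apply: cvgB; last exact: cvg_cst.
by apply: cvgM (cvg_cst _); rewrite expr2; under eq_fun do rewrite expr2; exact: cvgM.
Qed.

Let near_oo (P : R -> Prop) : (\forall t \near +oo, P t) -> exists M, forall t, M <= t -> P t.
Proof. by move=> [M [_ h]]; exists (M + 1) => t Mt; apply: h; lra. Qed.

(** Over a late unit of time the velocity gains at most [k / 2], so by the mean value theorem the
    force is below [k] at some instant, and [x] is then within [e] of [x0]. *)
Let returns (e M : R) : 0 < e -> exists2 t, M <= t & `|x t - x0| < e.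
Proof.
move=> e0; have [k k0 kg] := gaway e0.
have k40 : 0 < k / 4 by lra.
have [N yN] : exists N, forall t, N <= t -> `|l - y t| <= k / 4.
  by apply: near_oo; exact: cvgr_dist_le yl _ k40.
pose s := Num.max M N.
have ss : s <= s + 1 by lra.
have [t /andP[st _]] := is_derive1_MVT ss (fun t _ => (sol t).2).
have := yN s; have := yN (s + 1); rewrite {1 2}/s !le_max lexx orbT.
have -> : N <= s + 1 by apply: le_trans ss; rewrite le_max lexx orbT.
rewrite !ler_norml => /(_ isT) /andP[h1 h2] /(_ isT) /andP[h3 h4] yE.
exists t; first by apply: le_trans st; rewrite le_max lexx.
by rewrite ltNge; apply/negP => /kg; lra.
Qed.

(** [G (x t)] has a limit, and the recurrent visits of [x] near [x0] force it to be [G x0 = 0]. *)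
Let z0 : l ^+ 2 / 2 - E = 0.
Proof.
apply/eqP; apply: contraT => z0.
set z := l ^+ 2 / 2 - E in z0 *.
have z2 : 0 < `|z| / 2 by rewrite divr_gt0// normr_gt0.
have [M hM] : exists M, forall t, M <= t -> `|z - G (x t)| < `|z| / 2.
  by apply: near_oo; exact: cvgr_dist_lt Gl _ z2.
have : \forall u \near x0, `|G x0 - G u| < `|z| / 2 by move/cvgrPdist_lt : (@cG x0); apply.
move=> /nbhs_ballP[e /= e0 he].
have [t Mt xt] := returns M e0.
have := hM t Mt; have := he (x t); rewrite /ball/= distrC xt => /(_ isT).
rewrite G0 sub0r normrN -/z => h1 h2.
have := ler_normD (z - G (x t)) (G (x t)); rewrite subrK; lra.
Qed.

(** [G (x t)] tends to [G x0], and strict monotonicity of [G] transfers this to [x]. *)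
Lemma cusp_position_cvg : x t @[t --> +oo] --> x0.
Proof.
apply/cvgrPdist_le => e e0.
have Gl0 : G (x t) @[t --> +oo] --> 0 by rewrite -z0; exact: Gl.
have G1 : G (x0 - e) < 0 by rewrite -G0; apply: cusp_primitive_lt; lra.
have G2 : 0 < G (x0 + e) by rewrite -G0; apply: cusp_primitive_lt; lra.
near=> t.
have h1 : G (x0 - e) < G (x t) by near: t; exact: cvgr_gt Gl0 _ G1.
have h2 : G (x t) < G (x0 + e) by near: t; exact: cvgr_lt Gl0 _ G2.
rewrite ler_norml; apply/andP; split.
  rewrite leNgt; apply/negP => h.
  have : G (x0 + e) < G (x t) by apply: cusp_primitive_lt; lra.
  by rewrite ltNge ltW.
rewrite leNgt; apply/negP => h.
have : G (x t) < G (x0 - e) by apply: cusp_primitive_lt; lra.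
by rewrite ltNge ltW.
Unshelve. all: by end_near. Qed.

(** A nonzero limit velocity would displace [x] by about [l] in each unit of time, although [x]
    converges. *)
Let l0 : l = 0.
Proof.
apply/eqP; apply: contraT => l0.
have l8 : 0 < `|l| / 8 by rewrite divr_gt0// normr_gt0.
have [M hM] : exists M, forall t, M <= t -> `|x0 - x t| <= `|l| / 8.
  by apply: near_oo; exact: cvgr_dist_le cusp_position_cvg _ l8.
have [N hN] : exists N, forall t, N <= t -> `|l - y t| <= `|l| / 8.
  by apply: near_oo; exact: cvgr_dist_le yl _ l8.
pose s := Num.max M N.
have Ms : M <= s by rewrite le_max lexx.
have Ns : N <= s by rewrite le_max lexx orbT.
have ss : s <= s + 1 by lra.
have [t /andP[st _]] := is_derive1_MVT ss (fun t _ => (sol t).1).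
have := hM s Ms; have := hM (s + 1) (le_trans Ms ss); have := hN t (le_trans Ns st).
have l8' : 0 < `|l| by lra.
rewrite !ler_norml => /andP[h1 h2] /andP[h3 h4] /andP[h5 h6] e.
have [/ger0_norm|/ltr0_norm] := leP 0 l; lra.
Qed.

Lemma cusp_velocity_cvg : y t @[t --> +oo] --> 0.
Proof. by rewrite -l0; exact: yl. Qed.

Lemma cusp_velocity_le0 t : y t <= 0.
Proof.
rewrite leNgt; apply/negP => yt.
have [M hM] : exists M, forall s, M <= s -> y s < y t.
  by apply: near_oo; exact: cvgr_lt cusp_velocity_cvg _ yt.
have := hM (Num.max M t); rewrite le_max lexx => /(_ isT).
by rewrite ltNge cusp_velocity_ndecr// le_max lexx orbT.
Qed.

Lemma cusp_energy0 t : y t ^+ 2 / 2 - G (x t) = 0.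
Proof.
by rewrite (newton_energy_global dG sol t 0) -/E; have := z0; rewrite l0 expr0n/= mul0r sub0r => /eqP; rewrite oppr_eq0 => /eqP.
Qed.

End Bounded.

(** If [y] missed [y1] it would stay below it, so the orbit would tend to the equilibrium: zero
    energy, velocity nonpositive and tending to [0]. Each alternative contradicts one of these
    facts, or is met at time [0]. *)
Lemma cusp_reach (x y : R -> R) (y1 : R) : newton_solution g x y -> y 0 <= y1 ->
  [\/ y 0 ^+ 2 / 2 - G (x 0) != 0, 0 < y 0, y1 < 0 | y 0 = y1] ->
  exists2 t, 0 <= t & y t = y1.
Proof.
move=> sol y01 hy; apply: contrapT => nt.
have ny t : 0 <= t -> y t <= y1.
  move=> t0; rewrite leNgt; apply/negP => yt; apply: nt.
  have [||s] := @IVT R y 0 t y1 t0.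
  - by apply: continuous_subspaceT => r; exact: is_derive1_continuous (sol r).2.
  - by rewrite ge_min le_max y01 (ltW yt) orbT.
  by rewrite in_itv/= => /andP[s0 _] ys; exists s.
case: hy => [/eqP|y0|y10|ye].
- by apply; exact: cusp_energy0 sol ny 0.
- by have := cusp_velocity_le0 sol ny 0; rewrite leNgt y0.
- have : \forall t \near +oo, y1 < y t by exact: cvgr_gt (cusp_velocity_cvg sol ny) _ y10.
  move=> [M [_ hM]].
  have := hM (Num.max 0 (M + 1)) _; rewrite lt_max ltrDl ltr01 orbT => /(_ isT).
  by rewrite ltNge ny// le_max lexx.
- by apply: nt; exists 0.
Qed.

End CuspDynamics.

(** * The quadrant model and the order on its trajectories *)

Section SectorModel.
Context {R : realType}.
Local Notation plane := 'rV[R]_2.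

(* [w] increases along trajectories and [k] is a first integral; the
   disjunction forbids passing through the equilibrium [w = k = 0]. *)
Definition sector_order (w k w' k' : R) : Prop :=
  [/\ k = k', w <= w' & [\/ k != 0, 0 < w, w' < 0 | w = w']].

(** A negative [b] is allowed, as required by the sector on which [H = - delta u v]. *)
Lemma sector_order_scale (a b w k w' k' : R) : 0 < a -> b != 0 ->
  sector_order (a * w) (b * k) (a * w') (b * k') <-> sector_order w k w' k'.
Proof.
move=> a0 b0; rewrite /sector_order mulf_eq0 (negbTE b0)/= pmulr_rgt0// pmulr_rlt0// ler_pM2l//.
have aN : a != 0 by rewrite gt_eqF.
split=> [[/(mulfI b0) kk ww h]|[kk ww h]]; split => //.
- by case: h => [h|h|h|/(mulfI aN) h]; [constructor 1|constructor 2|constructor 3|constructor 4].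
- by rewrite kk.
- by case: h => [h|h|h|->]; [constructor 1|constructor 2|constructor 3|constructor 4].
Qed.

Lemma is_derive_expR_lin (k t : R) :
  is_derive t 1 (fun s => expR (k * s)) (k * expR (k * t)).
Proof.
have := @is_derive1_affine_comp _ expR k 0 t _ (is_derive_expR _).
by rewrite addr0; under eq_fun do rewrite addr0.
Qed.

Lemma linear_growth (k : R) (u : R -> R) (T : R) : 0 <= T ->
  (forall t, 0 <= t <= T -> is_derive t 1 u (k * u t)) -> u T = u 0 * expR (k * T).
Proof.
move=> T0 du.
have : u 0 * expR (- k * 0) = u T * expR (- k * T).
  apply: (@is_derive1_eq0_cst _ (fun t => u t * expR (- k * t)) 0 T); rewrite ?lexx ?T0//.
  move=> t tT; have d1 := du t tT; have d2 := is_derive_expR_lin (- k) t.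
  have -> : (fun t => u t * expR (- k * t)) = u * (fun t => expR (- k * t)) by [].
  by apply: is_derive_eq; rewrite /GRing.scale/=; ring.
by rewrite mulr0 expR0 mulr1 => ->; rewrite -mulrA -expRD mulNr addNr expR0 mulr1.
Qed.

Lemma linear_saddle_reaches (q q' : plane) (T : R) : 0 <= T ->
  unit_square q -> unit_square q' ->
  q' ord0 0 = q ord0 0 * expR T -> q' ord0 1 = q ord0 1 * expR (- T) ->
  reaches linear_saddle_field unit_square q q'.
Proof.
move=> T0 [/andP[q0 q0'] /andP[q1 q1']] [/andP[r0 r0'] /andP[r1 r1']] e0 e1.
exists T, (fun t => vec2 (q ord0 0 * expR (1 * t)) (q ord0 1 * expR (-1 * t))); split => //.
- move=> t; rewrite /= in_itv/= => /andP[t0 tT]; split.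
    rewrite /unit_square /= vec2E0 vec2E1 !mulr_ge0 ?expR_ge0//=.
    split.
      by apply: le_trans r0'; rewrite e0 ler_wpM2l// mul1r ler_expR.
    by apply: le_trans q1'; rewrite ler_piMr// mulN1r -expR0 ler_expR oppr_le0.
  apply/is_derive_row2; rewrite /linear_saddle_field !vec2E0 !vec2E1.
  under eq_fun do rewrite vec2E0; under [X in _ /\ is_derive _ _ X _]eq_fun do rewrite vec2E1.
  have d1 := is_derive_expR_lin 1 t; have d2 := is_derive_expR_lin (-1) t.
  by split; apply: is_derive_eq; rewrite /GRing.scale/=; ring.
- by rewrite !mulr0 expR0 !mulr1 vec2_eta.
- by apply: row2P; rewrite ?vec2E0 ?vec2E1 ?e0 ?e1 ?mul1r ?mulN1r.
Qed.

Lemma linear_saddle_reachesP (q q' : plane) : unit_square q -> unit_square q' ->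
  reaches linear_saddle_field unit_square q q' <->
  sector_order (q ord0 0 - q ord0 1) (q ord0 0 * q ord0 1)
    (q' ord0 0 - q' ord0 1) (q' ord0 0 * q' ord0 1).
Proof.
move=> Sq Sq'; move: (Sq) (Sq') => [/andP[q0 _] /andP[q1 _]] [/andP[r0 _] /andP[r1 _]].
split=> [[T [c [T0 sol c0 cT]]]|[kk ww h]].
  have e0 : q' ord0 0 = q ord0 0 * expR T.
    have := @linear_growth 1 (fun t => c t ord0 0) T T0; rewrite cT c0 mul1r; apply.
    move=> t tT; have [|_ /is_derive_row2[+ _]] := sol t; first by rewrite /= in_itv.
    by rewrite vec2E0 mul1r.
  have e1 : q' ord0 1 = q ord0 1 * expR (- T).
    have := @linear_growth (-1) (fun t => c t ord0 1) T T0; rewrite cT c0 mulN1r; apply.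
    move=> t tT; have [|_ /is_derive_row2[_ +]] := sol t; first by rewrite /= in_itv.
    by rewrite vec2E1 mulN1r.
  have ET : expR T * expR (- T) = 1 by rewrite -expRD subrr expR0.
  have ge1 : 1 <= expR T by rewrite -expR0 ler_expR.
  have := expR_gt0 T; have := expR_gt0 (- T) => gN gT.
  have le1 : expR (- T) <= 1 by rewrite -expR0 ler_expR oppr_le0.
  rewrite e0 e1; split.
  - by rewrite mulrACA ET mulr1.
  - apply: lerB; first by rewrite ler_peMr.
    by rewrite ler_piMr.
  have [u0|u0] := eqVneq (q ord0 0) 0.
    have [v0|v0] := eqVneq (q ord0 1) 0.
      by constructor 4; rewrite u0 v0 !mul0r.
    by constructor 3; rewrite u0 mul0r sub0r oppr_lt0 mulr_gt0// lt_neqAle eq_sym v0.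
  have [v0|v0] := eqVneq (q ord0 1) 0.
    by constructor 2; rewrite v0 subr0 lt_neqAle eq_sym u0.
  by constructor 1; rewrite mulf_neq0.
(* The travel time is read off the growth of the first coordinate when it is positive at both ends,
   and otherwise off the decay of the second. *)
have [/andP[u0 u0']|hu] := boolP ((0 < q ord0 0) && (0 < q' ord0 0)).
  have uu : q ord0 0 <= q' ord0 0 by rewrite leNgt; apply/negP => ?; nra.
  have uN : q ord0 0 != 0 by rewrite gt_eqF.
  have uN' : q' ord0 0 != 0 by rewrite gt_eqF.
  apply: (@linear_saddle_reaches _ _ (ln (q' ord0 0 / q ord0 0))) => //.
  - by rewrite ln_ge0// ler_pdivlMr// mul1r.
  - by rewrite lnK ?posrE ?divr_gt0//; field.
  - rewrite expRN lnK ?posrE ?divr_gt0// invf_div mulrA (mulrC (q ord0 1)) kk.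
    by field.
have [/andP[v0 v0']|hv] := boolP ((0 < q ord0 1) && (0 < q' ord0 1)).
  have vv : q' ord0 1 <= q ord0 1 by rewrite leNgt; apply/negP => ?; nra.
  have vN : q ord0 1 != 0 by rewrite gt_eqF.
  have vN' : q' ord0 1 != 0 by rewrite gt_eqF.
  apply: (@linear_saddle_reaches _ _ (ln (q ord0 1 / q' ord0 1))) => //.
  - by rewrite ln_ge0// ler_pdivlMr// mul1r.
  - by rewrite lnK ?posrE ?divr_gt0// mulrA kk; field.
  - by rewrite expRN lnK ?posrE ?divr_gt0// invf_div; field.
(* Neither coordinate is now positive at both ends, so [k = 0]. A start with [0 < w] or an end with
   [w' < 0] contradicts [ww], and [w = w'] leaves only [q' = q]. *)
have hu' : q ord0 0 = 0 \/ q' ord0 0 = 0.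
  by move: hu; rewrite negb_and -!leNgt => /orP[] ?; [left|right]; lra.
have hv' : q ord0 1 = 0 \/ q' ord0 1 = 0.
  by move: hv; rewrite negb_and -!leNgt => /orP[] ?; [left|right]; lra.
have k0 : q ord0 0 * q ord0 1 = 0.
  by case: hu' => e; [rewrite e mul0r|rewrite kk e mul0r].
suff -> : q' = q.
  by apply: (@linear_saddle_reaches _ _ 0) => //; rewrite ?oppr0 expR0 mulr1.
case: h => [|h|h|h]; first by rewrite k0 eqxx.
- by exfalso; case: hu' => e; case: hv' => e'; rewrite e ?e' in h ww; lra.
- by exfalso; case: hu' => e; case: hv' => e'; rewrite e ?e' in h ww; lra.
apply: row2P; nra.
Qed.

End SectorModel.

(** * The two sectors of a cusp and their charts *)

Section CuspSectors.
Context {R : realType}.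
Local Notation plane := 'rV[R]_2.
Variables (f g G : R -> R) (L c d x0 delta : R).
Hypotheses (gL : forall x y : R, `|g x - g y| <= L * `|x - y|)
  (dG : forall z : R, is_derive z 1 G (g z)) (G0 : G x0 = 0)
  (g0 : g x0 = 0)
  (gaway : forall e : R, 0 < e -> exists2 k : R, 0 < k & forall z, e <= `|z - x0| -> k <= g z)
  (cd : c < d) (fg : forall x, c <= x <= d -> f x = g x)
  (d0 : 0 < delta) (dc : G c < - delta) (dd : delta ^+ 2 / 2 + delta < G d).

Let cG : continuous G. Proof. by move=> z; exact: is_derive1_continuous (dG z). Qed.

Let G_lt u v : u < v -> G u < G v. Proof. exact: (cusp_primitive_lt dG gaway). Qed.

Let G_inj u v : G u = G v -> u = v. Proof. exact: (cusp_primitive_inj dG gaway). Qed.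

Let H := energy G.

Let H_inj (q r : plane) : H q = H r -> q ord0 1 = r ord0 1 -> q = r.
Proof.
rewrite /H /energy => Hqr e; apply: row2P => //; apply: G_inj.
by rewrite e in Hqr; lra.
Qed.

(** Here [- delta <= G x <= delta ^+ 2 / 2 + delta], which [dc] and [dd] place strictly between
    [G c] and [G d]. *)
Lemma cusp_level_itv (x y h : R) : G x = y ^+ 2 / 2 - h -> `|y| <= delta -> `|h| <= delta ->
  c < x < d.
Proof.
rewrite !ler_norml => Gx /andP[y1 y2] /andP[h1 h2].
have y22 : y ^+ 2 <= delta ^+ 2.
  rewrite -subr_ge0 (_ : _ - _ = (delta - y) * (delta + y)); last by ring.
  by apply: mulr_ge0; lra.
have y0 : 0 <= y ^+ 2 by exact: sqr_ge0.
have Gcx : G c < G x by apply: lt_le_trans dc _; rewrite Gx; lra.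
have Gxd : G x < G d by apply: le_lt_trans dd; rewrite Gx; lra.
apply/andP; split; rewrite ltNge; apply/negP; rewrite le_eqVlt => /orP[/eqP e|/G_lt/ltW].
- by rewrite e ltxx in Gcx.
- by rewrite leNgt Gcx.
- by rewrite e ltxx in Gxd.
- by rewrite leNgt Gxd.
Qed.

(* [s] is [1] or [- 1], and selects the side of the level [H = 0]. *)
Definition cusp_sector (s : R) : set plane :=
  [set q | 0 <= s * H q /\ `|q ord0 1| + s * H q <= delta].

Definition cusp_in : set plane := [set q | H q = 0 /\ - delta <= q ord0 1 < 0].
Definition cusp_out : set plane := [set q | H q = 0 /\ 0 < q ord0 1 <= delta].

Section Sector.
Variable s : R.
Hypothesis s1 : s * s = 1.

Let sN : s != 0. Proof. by apply/eqP => e; move: s1; rewrite e mul0r => /eqP; rewrite eq_sym oner_eq0. Qed.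

Let s_norm (h : R) : 0 <= s * h -> `|h| = s * h.
Proof.
move=> sh; have : `|s * h| = s * h by rewrite ger0_norm.
rewrite normrM; have -> : `|s| = 1; last by rewrite mul1r.
have : `|s| ^+ 2 = 1 by rewrite real_normK ?num_real// expr2.
by move/eqP; rewrite sqrf_eq1 => /orP[/eqP//|/eqP]; have := normr_ge0 s; lra.
Qed.

Lemma cusp_sector_itv (q : plane) : cusp_sector s q -> c < q ord0 0 < d.
Proof.
move=> [h0 h1]; apply: (@cusp_level_itv _ (q ord0 1) (H q)).
- by rewrite /H /energy; ring.
- lra.
- by rewrite s_norm//; have := normr_ge0 (q ord0 1); lra.
Qed.

(** Forwards: conservation, monotone velocity and no crossing. Backwards: the truncated orbit from
    [q] is run until its velocity equals that of [r], and [(y, H)] being injective identifies the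
    endpoint. *)
Lemma cusp_sector_reachesP (q r : plane) : cusp_sector s q -> cusp_sector s r ->
  reaches (newton_field f) (cusp_sector s) q r <->
  sector_order (q ord0 1) (H q) (r ord0 1) (H r).
Proof.
move=> Sq Sr; split=> [[T [k [T0 /newton_field_solution sol k0 kT]]]|[HH ww h]].
  pose x t := k t ord0 0; pose y t := k t ord0 1.
  have sol' t : 0 <= t <= T -> newton_at g x y t.
    move=> tT; have [|Skt [dx dy]] := sol t; first by rewrite /= in_itv.
    split => //; rewrite -fg//.
    by have /andP[/ltW -> /ltW ->] := cusp_sector_itv Skt.
  have H0 : H q = y 0 ^+ 2 / 2 - G (x 0) by rewrite -k0.
  have HT : H r = y T ^+ 2 / 2 - G (x T) by rewrite -kT.
  have T0T : (0 : R) <= 0 <= T by apply/andP; split.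
  have TT : (0 : R) <= T <= T by apply/andP; split.
  have yq : q ord0 1 = y 0 by rewrite -k0.
  have yr : r ord0 1 = y T by rewrite -kT.
  rewrite yq yr; split.
  - by rewrite H0 HT; exact: (newton_energy_cst dG sol').
  - apply: (@is_derive1_ge0_le _ y (fun t => g (x t))) => // t tT; first exact: (sol' t tT).2.
    have [->|xt] := eqVneq (x t) x0; first by rewrite g0.
    have [|e e0 eg] := gaway (e := `|x t - x0|); first by rewrite normr_gt0 subr_eq0.
    by apply: le_trans (eg _ (lexx _)); exact: ltW.
  - have [H00|H00] := eqVneq (H q) 0; last by constructor 1.
    have [h|h|h] := cusp_no_crossing gL dG G0 g0 gaway T0 sol' (etrans (esym H0) H00).
    + by constructor 2.
    + by constructor 3.
    + by constructor 4.
have [x [y [sol xq yq]]] := newton_solution_exists gL (q ord0 0) (q ord0 1).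
have Hq : y 0 ^+ 2 / 2 - G (x 0) = H q by rewrite xq yq.
have [||T T0 yT] := @cusp_reach _ g G x0 dG G0 g0 gaway x y (r ord0 1) sol.
- by rewrite yq.
- by rewrite Hq yq.
have Ht t : H (vec2 (x t) (y t)) = H q.
  by rewrite -Hq /H /energy vec2E0 vec2E1; exact: newton_energy_global dG sol _ _.
exists T, (fun t => vec2 (x t) (y t)); split => //.
- apply/newton_field_solution => t; rewrite /= in_itv/= => /andP[t0 tT].
  (* [H] is constant and [y t] lies between the two end velocities, both of absolute value at most
     [delta - s * H q]. *)
  have St : cusp_sector s (vec2 (x t) (y t)).
    rewrite /cusp_sector /= Ht vec2E1; case: (Sq) => q1 q2; split => //.
    case: (Sr) => r1 r2; rewrite -HH in r1 r2.
    have := cusp_velocity_ndecr g0 gaway sol t0; have := cusp_velocity_ndecr g0 gaway sol tT.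
    rewrite yT yq => y2 y1.
    have : `|y t| <= delta - s * H q; last by lra.
    have : `|q ord0 1| <= delta - s * H q by lra.
    have : `|r ord0 1| <= delta - s * H q by lra.
    by rewrite !ler_norml => /andP[? ?] /andP[? ?]; apply/andP; split; lra.
  split => //; under eq_fun do rewrite vec2E0; under [X in newton_at _ _ X]eq_fun do rewrite vec2E1.
  have [dx dy] := sol t; split => //.
  by rewrite fg//; have := cusp_sector_itv St; rewrite vec2E0 => /andP[/ltW -> /ltW ->].
- by rewrite xq yq vec2_eta.
- by apply: H_inj; rewrite ?Ht ?vec2E1.
Qed.

Section SectorChart.
Variable k : R -> R.
Hypothesis kP : forall z, G c <= z <= G d -> c <= k z <= d /\ G (k z) = z.

Let s_cases : s = 1 \/ s = -1.
Proof. by have := s1; rewrite -expr2 => /eqP; rewrite sqrf_eq1 => /orP[/eqP|/eqP]; [left|right]. Qed.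

Let k_cts (z : R) : G c < z < G d -> {for z, continuous k}.
Proof.
move=> /andP[cz zd].
have [ckd Gk] := kP (introT andP (conj (ltW cz) (ltW zd))).
apply/cvgrPdist_le => e e0; near=> z'.
have h1 : G (k z - e) < z'.
  by near: z'; apply: lt_nbhsr; rewrite -[X in _ < X]Gk; apply: G_lt; rewrite ltrBlDr ltrDl.
have h2 : z' < G (k z + e).
  by near: z'; apply: lt_nbhsl; rewrite -[X in X < _]Gk; apply: G_lt; rewrite ltrDl.
have h3 : G c < z' by near: z'; exact: lt_nbhsr.
have h4 : z' < G d by near: z'; exact: lt_nbhsl.
have [_ Gk'] := kP (introT andP (conj (ltW h3) (ltW h4))).
rewrite -Gk' in h1 h2.
rewrite ler_norml; apply/andP; split.
  rewrite leNgt; apply/negP => h.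
  have : G (k z + e) < G (k z') by apply: G_lt; lra.
  by rewrite ltNge ltW.
rewrite leNgt; apply/negP => h.
have : G (k z') < G (k z - e) by apply: G_lt; lra.
by rewrite ltNge ltW.
Unshelve. all: by end_near. Qed.

(** The value that [G] must take at the first coordinate for the energy to be [s * delta * u * v]
    when the velocity is [delta * (u - v)]. *)
Definition chart_level (q : plane) : R :=
  (delta * (q ord0 0 - q ord0 1)) ^+ 2 / 2 - s * delta * (q ord0 0 * q ord0 1).

Definition chart (q : plane) : plane :=
  vec2 (k (chart_level q)) (delta * (q ord0 0 - q ord0 1)).

(** Recovers [u] and [v] from their difference and product through
    [u + v = sqrt ((u - v) ^+ 2 + 4 * u * v)]. *)
Definition chart_inv (r : plane) : plane :=
  vec2 ((Num.sqrt ((r ord0 1 / delta) ^+ 2 + 4 * (s * H r / delta)) + r ord0 1 / delta) / 2)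
    ((Num.sqrt ((r ord0 1 / delta) ^+ 2 + 4 * (s * H r / delta)) - r ord0 1 / delta) / 2).

(** For [v <= u] the last bound is [(u - 1) * (1 + v) <= 0], and symmetrically otherwise; it
    explains the shape of [cusp_sector] as the image of the unit square. *)
Let square_bounds (q : plane) : unit_square q ->
  [/\ 0 <= q ord0 0 * q ord0 1 <= 1,
     (q ord0 0 - q ord0 1) ^+ 2 <= 1 &
     `|q ord0 0 - q ord0 1| + q ord0 0 * q ord0 1 <= 1].
Proof.
move=> [/andP[u0 u1] /andP[v0 v1]].
move: (q ord0 0) (q ord0 1) u0 u1 v0 v1 => u v u0 u1 v0 v1.
split.
- by apply/andP; split; nra.
- nra.
- by have [/ger0_norm ->|/ltr0_norm ->] := leP 0 (u - v); nra.
Qed.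

Let chart_level_itv q : unit_square q -> G c < chart_level q < G d.
Proof.
move=> /square_bounds[/andP[uv0 uv1] w1 _]; rewrite /chart_level exprMn.
have w0 := sqr_ge0 (q ord0 0 - q ord0 1).
have d0' := d0; have d20 := sqr_ge0 delta.
move: (q ord0 0 * q ord0 1) uv0 uv1 => uv uv0 uv1.
move: ((q ord0 0 - q ord0 1) ^+ 2) w0 w1 => w w0 w1.
have : 0 <= delta ^+ 2 * w <= delta ^+ 2 by rewrite mulr_ge0//= ler_piMr.
have : 0 <= delta * uv <= delta by rewrite mulr_ge0 ?(ltW d0)//= ler_piMr// ltW.
move=> /andP[a1 a2] /andP[a3 a4].
apply/andP; split.
  by apply: lt_le_trans dc _; case: s_cases => ->; lra.
by apply: le_lt_trans dd; case: s_cases => ->; lra.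
Qed.

Let chartE0 q : unit_square q -> G (chart q ord0 0) = chart_level q.
Proof.
move=> /chart_level_itv/andP[h1 h2]; rewrite vec2E0.
by have [] := kP (introT andP (conj (ltW h1) (ltW h2))).
Qed.

Let chartE1 q : chart q ord0 1 = delta * (q ord0 0 - q ord0 1).
Proof. by rewrite vec2E1. Qed.

Let chartH q : unit_square q -> H (chart q) = s * delta * (q ord0 0 * q ord0 1).
Proof. by move=> Sq; rewrite /H /energy chartE0// chartE1 /chart_level; ring. Qed.

Let chart_in q : unit_square q -> cusp_sector s (chart q).
Proof.
move=> Sq; rewrite /cusp_sector /= chartH// chartE1.
have -> : s * (s * delta * (q ord0 0 * q ord0 1)) = delta * (q ord0 0 * q ord0 1).
  by rewrite !mulrA s1 mul1r.
have [/andP[uv0 uv1] _ h] := square_bounds Sq.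
split; first by rewrite mulr_ge0// ltW.
rewrite normrM (gtr0_norm d0) -mulrDr; by rewrite ler_piMr// ltW.
Qed.

Let dN : delta != 0. Proof. by rewrite gt_eqF. Qed.

Let chartK q : unit_square q -> chart_inv (chart q) = q.
Proof.
move=> Sq; rewrite /chart_inv chartH// chartE1.
have -> : delta * (q ord0 0 - q ord0 1) / delta = q ord0 0 - q ord0 1 by field.
have -> : s * (s * delta * (q ord0 0 * q ord0 1)) / delta = q ord0 0 * q ord0 1.
  by rewrite !mulrA s1; field.
have -> : (q ord0 0 - q ord0 1) ^+ 2 + 4 * (q ord0 0 * q ord0 1) =
  (q ord0 0 + q ord0 1) ^+ 2 by ring.
have [/andP[u0 _] /andP[v0 _]] := Sq.
rewrite sqrtr_sqr ger0_norm ?addr_ge0//.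
by apply: row2P; rewrite ?vec2E0 ?vec2E1; field.
Qed.

Let chart_invP r : cusp_sector s r -> unit_square (chart_inv r) /\ chart (chart_inv r) = r.
Proof.
move=> [h0 h1].
set w := r ord0 1 / delta; set e := s * H r / delta.
have e0 : 0 <= e by rewrite divr_ge0// ltW.
have w1 : `|w| + e <= 1.
  by rewrite normrM normfV (gtr0_norm d0) -mulrDl ler_pdivrMr// mul1r.
pose t := Num.sqrt (w ^+ 2 + 4 * e).
have t0 : 0 <= t by exact: sqrtr_ge0.
have t2 : t ^+ 2 = w ^+ 2 + 4 * e.
  by rewrite sqr_sqrtr// addr_ge0 ?sqr_ge0// mulr_ge0.
have ww : `|w| ^+ 2 = w ^+ 2 by rewrite real_normK ?num_real.
have w0 := normr_ge0 w.
(* With [t = u + v], the bound [|w| <= t] gives nonnegative coordinates and [t <= 2 - |w|]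
   coordinates at most [1]; the latter squares to [|w| + e <= 1]. *)
have tw : `|w| <= t by rewrite -(ler_pXn2r (_ : 0 < 2)%N)// ?nnegrE// ww t2; lra.
have tw2 : t <= 2 - `|w|.
  rewrite -(ler_pXn2r (_ : 0 < 2)%N)// ?nnegrE//; last lra.
  by rewrite t2 -ww; nra.
have := ler_norm w; have := ler_norm (- w); rewrite normrN => wl wr.
have SQ : unit_square (chart_inv r).
  rewrite /unit_square /= vec2E0 vec2E1 -/w -/e -/t.
  by split; apply/andP; split; lra.
split => //.
apply: H_inj.
  rewrite chartH// vec2E0 vec2E1 -/w -/e -/t.
  have -> : (t + w) / 2 * ((t - w) / 2) = (t ^+ 2 - w ^+ 2) / 4 by field.
  rewrite t2 (_ : (w ^+ 2 + 4 * e - w ^+ 2) / 4 = e); last by field.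
  rewrite /e (_ : s * delta * (s * H r / delta) = (s * s) * H r); last by field.
  by rewrite s1 mul1r.
by rewrite chartE1 vec2E0 vec2E1 -/w -/e -/t /w; field.
Qed.

Let chart_cts : {in unit_square, continuous chart}.
Proof.
move=> q; rewrite inE => Sq.
have c0 : {for q, continuous (fun M : plane => M ord0 0)} by exact: coord_continuous.
have c1 : {for q, continuous (fun M : plane => M ord0 1)} by exact: coord_continuous.
have cw : {for q, continuous (fun M : plane => delta * (M ord0 0 - M ord0 1))}.
  exact: (continuousM (@cst_continuous _ R delta q) (continuousB c0 c1)).
have cl : {for q, continuous chart_level}.
  have h := continuousB (continuousM (@cst_continuous _ R 2^-1 q) (continuousM cw cw))
    (continuousM (@cst_continuous _ R (s * delta) q) (continuousM c0 c1)).
  have -> : chart_level = (fun M : plane => 2^-1 * (delta * (M ord0 0 - M ord0 1) * (delta * (M ord0 0 - M ord0 1)))) -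
      (fun M : plane => s * delta * (M ord0 0 * M ord0 1)).
    by apply/funext => M; rewrite /chart_level !fctE; ring.
  exact: h.
have ck : {for q, continuous (fun M => k (chart_level M))}.
  exact: (continuous_comp cl (k_cts (chart_level_itv Sq))).
exact: continuous_vec2 ck cw.
Qed.

Let chart_inv_cts : continuous chart_inv.
Proof.
move=> r.
have c1 : {for r, continuous (fun M : plane => M ord0 1)} by exact: coord_continuous.
have cw : {for r, continuous (fun M : plane => M ord0 1 * delta^-1)}.
  exact: (continuousM c1 (@cst_continuous _ R delta^-1 r)).
have cH : {for r, continuous H} by exact: continuous_energy.
have ct : {for r, continuous (fun M : plane => Num.sqrt ((M ord0 1 / delta) ^+ 2 + 4 * (s * H M / delta)))}.
  have h := continuousD (continuousM cw cw)
     (continuousM (@cst_continuous _ R (4 * s / delta) r) cH).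
  have -> : (fun M : plane => Num.sqrt ((M ord0 1 / delta) ^+ 2 + 4 * (s * H M / delta))) =
     Num.sqrt \o ((fun M : plane => (M ord0 1 / delta) * (M ord0 1 / delta)) + (fun M => 4 * s / delta * H M)).
    by apply/funext => M; rewrite /= !fctE; congr Num.sqrt; ring.
  exact: (continuous_comp h (@sqrt_continuous R _)).
have c2 := @cst_continuous _ R 2^-1 r.
exact: (continuous_vec2 (continuousM (continuousD ct cw) c2) (continuousM (continuousB ct cw) c2)).
Qed.

(** Reachability is [sector_order] on both sides, and the chart only rescales its two coordinates,
    by [delta] and [s * delta]. *)
Lemma cusp_hyperbolic_sector :
  hyperbolic_sector (newton_field f) (vec2 x0 0) (cusp_sector s) cusp_in cusp_out.
Proof.
exists chart; split.
- split.
    split.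
    + split=> [q Sq|q r|r Sr]; first exact: chart_in.
        by rewrite !inE => Sq Sr e; rewrite -(chartK Sq) -(chartK Sr) e.
      by have [? ?] := chart_invP Sr; exists (chart_inv r).
    + exact: continuous_in_subspaceT chart_cts.
    + exists chart_inv; last exact: chartK.
      exact: continuous_subspaceT.
  move=> q r Sq Sr; rewrite linear_saddle_reachesP//.
  have sd : s * delta != 0 by rewrite mulf_neq0.
  rewrite (cusp_sector_reachesP (chart_in Sq) (chart_in Sr)) !chartH// !chartE1.
  by rewrite sector_order_scale.
- have S0 : unit_square (0 : plane) by rewrite /unit_square /= !mxE lexx ler01.
  apply: H_inj; last by rewrite chartE1 vec2E1 !mxE subrr mulr0.
  by rewrite chartH// /H /energy vec2E0 vec2E1 !mxE G0; ring.
- apply/seteqP; split => [_ [q [u0 /andP[v0 v1]] <-]|r [Hr /andP[r1 r2]]].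
    have Sq : unit_square q by rewrite /unit_square /= u0 lexx ler01 (ltW v0) v1.
    split; first by rewrite chartH// u0 mul0r mulr0.
    by rewrite chartE1 u0 sub0r mulrN lerN2 oppr_lt0 mulr_gt0// ler_piMr// ltW.
  have Sr : cusp_sector s r.
    by rewrite /cusp_sector /= Hr mulr0 lexx addr0 ltr0_norm// lerNl.
  have [Sq <-] := chart_invP Sr; exists (chart_inv r) => //.
  (* [H = 0] forces [u * v = 0], and the sign of the velocity selects the half-axis. *)
  have := chartE1 (chart_inv r); have := chartH Sq; rewrite (chart_invP Sr).2 Hr => /eqP.
  rewrite eq_sym !mulf_eq0 (negbTE sN) (negbTE dN)/= => uv e.
  have [/andP[u0 u1] /andP[v0 v1]] := Sq.
  have uv' : chart_inv r ord0 0 < chart_inv r ord0 1.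
    by rewrite -subr_lt0 -(pmulr_rlt0 _ d0) -e.
  rewrite /model_incoming /= v1 andbT; case/orP: uv => /eqP u; first by rewrite u in uv' *.
  by exfalso; lra.
- apply/seteqP; split => [_ [q [/andP[u0 u1] v0] <-]|r [Hr /andP[r1 r2]]].
    have Sq : unit_square q by rewrite /unit_square /= v0 lexx ler01 (ltW u0) u1.
    split; first by rewrite chartH// v0 !mulr0.
    by rewrite chartE1 v0 subr0 mulr_gt0//= ler_piMr// ltW.
  have Sr : cusp_sector s r.
    by rewrite /cusp_sector /= Hr mulr0 lexx addr0 gtr0_norm.
  have [Sq <-] := chart_invP Sr; exists (chart_inv r) => //.
  have := chartE1 (chart_inv r); have := chartH Sq; rewrite (chart_invP Sr).2 Hr => /eqP.
  rewrite eq_sym !mulf_eq0 (negbTE sN) (negbTE dN)/= => uv e.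
  have [/andP[u0 u1] /andP[v0 v1]] := Sq.
  have uv' : chart_inv r ord0 1 < chart_inv r ord0 0.
    by rewrite -subr_gt0 -(pmulr_rgt0 _ d0) -e.
  rewrite /model_outgoing /= u1 andbT; case/orP: uv => /eqP u; last by rewrite u in uv' *.
  by exfalso; lra.
Qed.

End SectorChart.

End Sector.

End CuspSectors.

(** * Separatrices and the neighborhood of a cusp *)

Section CuspNeighborhood.
Context {R : realType}.
Local Notation plane := 'rV[R]_2.
Variables (f g G : R -> R) (L c d x0 delta : R).
Hypotheses (gL : forall x y : R, `|g x - g y| <= L * `|x - y|)
  (dG : forall z : R, is_derive z 1 G (g z)) (G0 : G x0 = 0)
  (g0 : g x0 = 0)
  (gaway : forall e : R, 0 < e -> exists2 k : R, 0 < k & forall z, e <= `|z - x0| -> k <= g z)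
  (cd : c < d) (fg : forall x, c <= x <= d -> f x = g x)
  (d0 : 0 < delta) (dc : G c < - delta) (dd : delta ^+ 2 / 2 + delta < G d).

Let cG : continuous G. Proof. by move=> z; exact: is_derive1_continuous (dG z). Qed.

Lemma cusp_primitive_inverse :
  exists k : R -> R, forall z, G c <= z <= G d -> c <= k z <= d /\ G (k z) = z.
Proof.
suff H z : exists x, G c <= z <= G d -> c <= x <= d /\ G x = z.
  by have [k kP] := choice H; exists k.
have [/andP[cz zd]|] := boolP (G c <= z <= G d); last by exists 0.
have [||x] := @IVT R G c d z (ltW cd); first exact: continuous_subspaceT.
  by rewrite ge_min le_max cz zd orbT.
by rewrite in_itv/= => cxd Gx; exists x.
Qed.

(** The orbit on the zero level started at velocity [- delta] keeps a negative velocity, hence is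
    bounded above and tends to the equilibrium, taking every velocity in [[- delta, 0[] on the
    way. *)
Lemma cusp_separatrix : exists x y : R -> R,
  [/\ newton_solution g x y, x t @[t --> +oo] --> x0, y t @[t --> +oo] --> 0,
     forall t, 0 <= t -> [/\ c < x t < d, - delta <= y t < 0 & y t ^+ 2 / 2 - G (x t) = 0] &
     forall w, - delta <= w < 0 -> exists2 t, 0 <= t & y t = w].
Proof.
have [k kP] := cusp_primitive_inverse.
have dd0 : 0 <= delta ^+ 2 by exact: sqr_ge0.
(* [delta ^+ 2 / 2] is the value of [G] on the zero level at velocity [- delta]. *)
have [_ Gk] : c <= k (delta ^+ 2 / 2) <= d /\ G (k (delta ^+ 2 / 2)) = delta ^+ 2 / 2.
  by apply: kP; have := dc; have := dd; have := d0 => *; apply/andP; split; lra.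
have [x [y [sol xk yd]]] := newton_solution_exists gL (k (delta ^+ 2 / 2)) (- delta).
have E0 : y 0 ^+ 2 / 2 - G (x 0) = 0 by rewrite xk yd Gk sqrrN subrr.
have Et t : y t ^+ 2 / 2 - G (x t) = 0.
  by rewrite (newton_energy_global dG sol t 0).
have y0 : y 0 < 0 by rewrite yd oppr_lt0.
have yt t : 0 <= t -> y t < 0.
  move=> t0.
  have [|//|<- //] := cusp_no_crossing gL dG G0 g0 gaway t0 (fun r _ => sol r) E0.
  by move=> h; have := lt_trans h y0; rewrite ltxx.
have yB t : 0 <= t -> y t <= 0 by move=> /yt/ltW.
have yt2 t : 0 <= t -> - delta <= y t < 0.
  by move=> t0; rewrite -yd yt// (cusp_velocity_ndecr g0 gaway sol t0).
exists x, y; split => //.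
- exact: (cusp_position_cvg dG G0 g0 gaway sol yB).
- exact: (cusp_velocity_cvg dG G0 g0 gaway sol yB).
- move=> t t0; split => //; last exact: yt2.
  apply: (@cusp_level_itv _ g G c d x0 delta dG gaway dc dd _ (y t) 0).
  + by have := Et t; lra.
  + have := d0; have /andP[h1 h2] := yt2 t t0; rewrite ler_norml => ?; apply/andP; split; lra.
  + by rewrite normr0 ltW.
- move=> w /andP[w1 w2].
  apply: (@cusp_reach _ g G x0 dG G0 g0 gaway x y w sol); first by rewrite yd.
  by constructor 3.
Qed.

Let G_inj u v : G u = G v -> u = v. Proof. exact: (cusp_primitive_inj dG gaway). Qed.

Let H := energy G.

Let H_inj (q r : plane) : H q = H r -> q ord0 1 = r ord0 1 -> q = r.
Proof.
rewrite /H /energy => Hqr e; apply: row2P => //; apply: G_inj.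
by rewrite e in Hqr; lra.
Qed.

Variable D : set plane.
Hypothesis DS : forall p : plane, c < p ord0 0 < d -> D p.

Let newton_solution_D (I : set R) (x y : R -> R) :
  (forall t, I t -> newton_at g x y t /\ c < x t < d) ->
  is_solution (newton_field f) D I (fun t => vec2 (x t) (y t)).
Proof.
move=> h; apply/newton_field_solution => t It.
have [[dx dy] xcd] := h t It; split; first by apply: DS; rewrite vec2E0.
under eq_fun do rewrite vec2E0; under [X in newton_at _ _ X]eq_fun do rewrite vec2E1.
by split => //; rewrite fg//; have /andP[/ltW -> /ltW ->] := xcd.
Qed.

Lemma cusp_in_trajectory :
  incoming_trajectory (newton_field f) D (vec2 x0 0) (cusp_in G delta).
Proof.
have [x [y [sol xcv ycv xyP yw]]] := cusp_separatrix.
exists (fun t => vec2 (x t) (y t)); split.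
- apply: newton_solution_D => t; rewrite /= in_itv/= andbT => t0; split => //.
  by have [] := xyP t t0.
- exact: cvg_vec2.
- apply/seteqP; split => [r [Hr /yw[t t0 yt]]|r [t tI <-]].
    exists t; first by rewrite /= in_itv/= t0.
    have [_ _ Ht] := xyP t t0.
    apply: H_inj; last by rewrite vec2E1.
    by rewrite {1}/H /energy vec2E0 vec2E1 Ht; exact/esym.
  have t0 : 0 <= t by move: tI; rewrite /= in_itv/= andbT.
  have [_ yt Ht] := xyP t t0.
  by rewrite /cusp_in /= /energy vec2E0 vec2E1.
Qed.

(** The incoming separatrix run backwards with its velocity negated. *)
Lemma cusp_out_trajectory :
  outgoing_trajectory (newton_field f) D (vec2 x0 0) (cusp_out G delta).
Proof.
have [x [y [sol xcv ycv xyP yw]]] := cusp_separatrix.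
have cvN : - t @[t --> (-oo : set_system R)] --> +oo.
  by apply/(@cvgNry _ _ _ _ id); exact: cvg_id.
exists (fun t => vec2 (x (0 - t)) (- y (0 - t))); split.
- apply: newton_solution_D => t; rewrite /= in_itv/= => t0.
  have t0' : 0 <= 0 - t by rewrite sub0r oppr_ge0.
  split; first exact: newton_reverse.
  by have [] := xyP _ t0'.
- have xN : x (0 - t) @[t --> (-oo : set_system R)] --> x0.
    by under eq_fun do rewrite sub0r; exact: (@cvg_comp _ _ _ (fun t : R => - t) x _ _ _ cvN xcv).
  have yN : - y (0 - t) @[t --> (-oo : set_system R)] --> 0.
    under eq_fun do rewrite sub0r.
    have := cvgN (@cvg_comp _ _ _ (fun t : R => - t) y _ _ _ cvN ycv).
    by rewrite oppr0; exact.
  exact: (cvg_vec2 xN yN).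
- apply/seteqP; split => [r [Hr /andP[r1 r2]]|r [t tI <-]].
    have [|t t0 yt] := yw (- r ord0 1); first by rewrite lerN2 r2 oppr_lt0.
    exists (- t); first by rewrite /= in_itv/= oppr_le0.
    have [_ _ Ht] := xyP t t0.
    rewrite sub0r opprK; apply: H_inj; last by rewrite vec2E1 yt opprK.
    by rewrite {1}/H /energy vec2E0 vec2E1 sqrrN Ht; exact/esym.
  have t0 : t <= 0 by move: tI; rewrite /= in_itv.
  have t0' : 0 <= 0 - t by rewrite sub0r oppr_ge0.
  have [_ /andP[y1 y2] Ht] := xyP _ t0'.
  by rewrite /cusp_out /= /energy vec2E0 vec2E1 sqrrN; split; rewrite ?Ht// oppr_gt0 y2 lerNl.
Qed.

(** The union of the two sectors is the set where [|y| + |H| <= delta]. *)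
Lemma cusp_sectors_nbhs : nbhs (vec2 x0 0) (cusp_sector G delta 1 `|` cusp_sector G delta (-1)).
Proof.
have cH := continuous_energy cG.
have Hp : energy G (vec2 x0 0) = 0.
  by rewrite /energy vec2E0 vec2E1 G0 expr0n/= mul0r subrr.
have d2 : 0 < delta / 2 by rewrite divr_gt0.
have n1 : \forall q \near vec2 x0 0, `|energy G q| < delta / 2.
  have : \forall q \near vec2 x0 0, `|energy G (vec2 x0 0) - energy G q| < delta / 2.
    by move/cvgrPdist_lt : (cH (vec2 x0 0)); apply.
  by rewrite Hp; apply: filterS => q; rewrite sub0r normrN.
have n2 : \forall q \near vec2 x0 0, `|(q : plane) ord0 1| < delta / 2.
  have c1 := @coord_continuous R 1 2 ord0 1 (vec2 x0 0).
  have : \forall q \near vec2 x0 0, `|vec2 x0 0 ord0 1 - (q : plane) ord0 1| < delta / 2.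
    by move/cvgrPdist_lt : c1; apply.
  by rewrite vec2E1; apply: filterS => q; rewrite sub0r normrN.
near=> q.
have h1 : `|energy G q| < delta / 2 by near: q.
have h2 : `|q ord0 1| < delta / 2 by near: q.
rewrite /cusp_sector /= mul1r mulN1r.
have [h|h] := leP 0 (energy G q).
  left; split => //; move: h1; rewrite ger0_norm//; lra.
right; split; first by rewrite oppr_ge0 ltW.
move: h1; rewrite ltr0_norm//; lra.
Unshelve. all: by end_near. Qed.

Lemma cusp_of_sectors :
  (forall x, c < x < d -> x != x0 -> f x != 0) -> c < x0 < d ->
  is_derive x0 1 f 0 -> cusp (newton_field f) D (vec2 x0 0).
Proof.
move=> fN0 x0cd df.
have fx0 : f x0 = 0 by rewrite fg//; have /andP[/ltW -> /ltW ->] := x0cd.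
have sec1 : (1 : R) * 1 = 1 by rewrite mulr1.
have sec2 : (-1 : R) * -1 = 1 by rewrite mulrNN mulr1.
have [k kP] := cusp_primitive_inverse.
have itv s (ss : s * s = 1) q : cusp_sector G delta s q -> c < q ord0 0 < d.
  exact: (cusp_sector_itv dG gaway dc dd ss).
split.
- split.
    by apply/newton_field_equilibria; rewrite vec2E0 vec2E1 fx0; split => //; apply: DS; rewrite vec2E0.
  apply: filterS cusp_sectors_nbhs => q Sq /newton_field_equilibria[_ fq yq].
  apply: row2P; rewrite ?vec2E0 ?vec2E1//; apply/eqP; apply: contraT => qx.
  have qcd : c < q ord0 0 < d by case: Sq => Sq; [exact: itv sec1 _ Sq|exact: itv sec2 _ Sq].
  by have := fN0 _ qcd qx; rewrite fq eqxx.
- exact: newton_degenerate.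
exists (cusp_sector G delta 1 `|` cusp_sector G delta (-1)), (cusp_sector G delta 1),
  (cusp_sector G delta (-1)), (cusp_in G delta), (cusp_out G delta); split.
- split; first exact: cusp_sectors_nbhs.
  by move=> q [Sq|Sq]; apply: DS; [exact: itv sec1 _ Sq|exact: itv sec2 _ Sq].
- by split; [exact: cusp_in_trajectory|exact: cusp_out_trajectory].
- by split; [exact: (cusp_hyperbolic_sector gL dG G0 g0 gaway fg d0 dc dd sec1 kP)|
     exact: (cusp_hyperbolic_sector gL dG G0 g0 gaway fg d0 dc dd sec2 kP)].
- by [].
(* The sectors meet where [H = 0] and [|y| <= delta]; the sign of [y] separates the two arcs from
   the equilibrium. *)
apply/seteqP; split => [q [[h1 h2] [h3 h4]]|q].
  rewrite mul1r in h1 h2; rewrite mulN1r oppr_ge0 in h3.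
  have Hq : energy G q = 0 by apply/eqP; rewrite eq_le h1 h3.
  rewrite Hq addr0 ler_norml in h2; case/andP: h2 => h2 h5.
  have [y0|y0|y0] := ltgtP (q ord0 1) 0.
  - by left; right; rewrite /cusp_in /= Hq h2 y0.
  - by right; rewrite /cusp_out /= Hq h5 y0.
  - left; left; apply: H_inj; last by rewrite vec2E1.
    by rewrite /H Hq /energy vec2E0 vec2E1 G0 expr0n/= mul0r subrr.
have e0 r : energy G r = 0 -> `|r ord0 1| <= delta ->
  (cusp_sector G delta 1 `&` cusp_sector G delta (-1)) r.
  by move=> Hq yq; split; rewrite /cusp_sector /= Hq mulr0 lexx addr0.
have dl := ltW d0.
case=> [[->|[Hq /andP[y1 y2]]]|[Hq /andP[y1 y2]]]; apply: e0 => //.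
- by rewrite /energy vec2E0 vec2E1 G0 expr0n/= mul0r subrr.
- by rewrite vec2E1 normr0.
- by rewrite ltr0_norm// lerNl.
- by rewrite gtr0_norm.
Qed.

End CuspNeighborhood.

(** * The criterion for a cusp, for both signs of the force *)

Section CuspTheorem.
Context {R : realType}.
Local Notation plane := 'rV[R]_2.

Theorem newton_cusp_pos (f : R -> R) (D : set plane) (L c x0 d : R) :
  c < x0 -> x0 < d -> 0 <= L ->
  (forall x y, c <= x <= d -> c <= y <= d -> `|f x - f y| <= L * `|x - y|) ->
  f x0 = 0 -> (forall x, c <= x <= d -> x != x0 -> 0 < f x) ->
  is_derive x0 1 f 0 -> (forall p : plane, c < p ord0 0 < d -> D p) ->
  cusp (newton_field f) D (vec2 x0 0).
Proof.
move=> cx0 x0d L0 fL f0 fpos df DS.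
have cd : c < d by apply: lt_trans x0d.
pose g x := f (clamp c d x).
have gL : forall x y, `|g x - g y| <= L * `|x - y| := clamp_comp_lipschitz (ltW cd) L0 fL.
have fg x : c <= x <= d -> f x = g x by move=> h; rewrite /g clampE.
have x0cd : c <= x0 <= d by rewrite (ltW cx0) ltW.
have g0 : g x0 = 0 by rewrite -fg.
have cg := lipschitz_cts gL.
have gaway (e : R) : 0 < e -> exists2 k : R, 0 < k & forall z, e <= `|z - x0| -> k <= g z.
  (* Shrinking [e] keeps both segments [[c, x0 - e']] and [[x0 + e', d]] nonempty; the smaller of
     the minima of [g] on them is the required bound. *)
  move=> e0; pose e' := Num.min e (Num.min (x0 - c) (d - x0)).
  have e'0 : 0 < e' by rewrite !lt_min e0 !subr_gt0 cx0.
  have [e'1 e'2 e'3] : [/\ e' <= e, e' <= x0 - c & e' <= d - x0].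
    by rewrite /e' !ge_min !lexx !orbT.
  have cl : c <= x0 - e' by lra.
  have cr : x0 + e' <= d by lra.
  have [a] := EVT_min cl (continuous_subspaceT (A := `[c, x0 - e']%classic) cg).
  rewrite in_itv/= => /andP[a1 a2] amin.
  have [b] := EVT_min cr (continuous_subspaceT (A := `[x0 + e', d]%classic) cg).
  rewrite in_itv/= => /andP[b1 b2] bmin.
  have ga : 0 < g a.
    have acd : c <= a <= d by apply/andP; split; lra.
    by rewrite -fg//; apply: fpos => //; rewrite lt_eqF//; lra.
  have gb : 0 < g b.
    have bcd : c <= b <= d by apply/andP; split; lra.
    by rewrite -fg//; apply: fpos => //; rewrite gt_eqF//; lra.
  have gcl z : g z = g (clamp c d z) by rewrite /g (clampE (clamp_itv (ltW cd) z)).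
  exists (Num.min (g a) (g b)); first by rewrite lt_min ga gb.
  move=> z; have /andP[cz zd] := clamp_itv (ltW cd) z.
  have [zx|zx] := leP 0 (z - x0); rewrite ?(ger0_norm zx) ?(ltr0_norm zx) => ez.
    rewrite ge_min; apply/orP; right; rewrite [g z]gcl; apply: bmin.
    by rewrite in_itv/= zd andbT /clamp le_max le_min cr andbT; apply/orP; right; lra.
  rewrite ge_min; apply/orP; left; rewrite [g z]gcl; apply: amin.
  by rewrite in_itv/= cz /= /clamp ge_max cl/= ge_min; apply/orP; left; lra.
have [U [_ dU]] := primitive_exists cg.
pose G x := U x - U x0.
have dG (z : R) : is_derive z 1 G (g z).
  by have ? := dU z; apply: is_derive_eq; rewrite subr0.
have G0 : G x0 = 0 by rewrite /G subrr.
have Gc : G c < 0 by rewrite -G0; exact: (cusp_primitive_lt dG gaway).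
have Gd : 0 < G d by rewrite -G0; exact: (cusp_primitive_lt dG gaway).
(* [delta <= 1] bounds [delta ^+ 2 / 2 + delta] by [3 / 2 * delta], at most three quarters of
   [G d]. *)
pose delta := Num.min 1 (Num.min (- G c / 2) (G d / 2)).
have d0 : 0 < delta by rewrite !lt_min ltr01 !divr_gt0// oppr_gt0.
have [d1 d2 d3] : [/\ delta <= 1, delta <= - G c / 2 & delta <= G d / 2].
  by rewrite /delta !ge_min !lexx !orbT.
have dc : G c < - delta by lra.
have dd : delta ^+ 2 / 2 + delta < G d by nra.
apply: (cusp_of_sectors gL dG G0 g0 gaway cd fg d0 dc dd DS) => //; last by rewrite cx0.
move=> x /andP[cx xd] xx0; rewrite gt_eqF// fpos//.
by rewrite (ltW cx) ltW.
Qed.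

Theorem newton_cusp_neg (f : R -> R) (D : set plane) (L c x0 d : R) :
  c < x0 -> x0 < d -> 0 <= L ->
  (forall x y, c <= x <= d -> c <= y <= d -> `|f x - f y| <= L * `|x - y|) ->
  f x0 = 0 -> (forall x, c <= x <= d -> x != x0 -> f x < 0) ->
  is_derive x0 1 f 0 -> (forall p : plane, c < p ord0 0 < d -> D p) ->
  cusp (newton_field f) D (vec2 x0 0).
Proof.
move=> cx0 x0d L0 fL f0 fneg df DS.
have [dF JF] := newton_degenerate df; apply: (cusp_reflect _ dF JF).
have -> : reflect_field (newton_field f) = newton_field (fun z => - f (- z)).
  by apply/funext => q; apply: row2P; rewrite /reflect_field /newton_field ?vec2E0 ?vec2E1 !mxE/= ?opprK.
have -> : - vec2 x0 0 = vec2 (- x0) 0 :> plane.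
  by apply: row2P; rewrite !mxE/= ?oppr0.
have itvN x : - d <= x <= - c -> c <= - x <= d.
  by move=> /andP[h1 h2]; rewrite lerNr h2 lerNl h1.
apply: (@newton_cusp_pos _ _ L (- d) (- x0) (- c)) => //.
- by rewrite ltrN2.
- by rewrite ltrN2.
- move=> x y /itvN hx /itvN hy.
  have -> : - f (- x) - - f (- y) = - (f (- x) - f (- y)) by ring.
  have -> : x - y = - (- x - - y) by ring.
  by rewrite !normrN; exact: fL.
- by rewrite opprK f0 oppr0.
- move=> x /itvN hx xx0; rewrite oppr_gt0; apply: fneg => //.
  by rewrite eqr_oppLR.
- have := @is_derive1_affine_comp _ f (-1) 0 (- x0) 0.
  have E s : -1 * s + 0 = - s :> R by ring.
  rewrite E opprK => /(_ df); under eq_fun do rewrite E.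
  by move=> h; have := is_deriveN h; rewrite mulr0 oppr0; exact.
- move=> p /andP[h1 h2]; apply: DS; rewrite mxE ltrNr h2 ltrNl h1 //.
Qed.

End CuspTheorem.

(** * The AFM force *)

Section LocalExtrema.
Context {R : realType}.

Lemma local_max_opp (A : set R) (h : R -> R) (x : R) :
  local_max_point A h x -> local_min_point A (fun t => - h t) x.
Proof.
move=> [Ax xmax]; split => //.
have xmax' : nbhs x (fun y => A y -> h y <= h x) by exact: xmax.
have : nbhs x (fun y => A y -> - h x <= - h y); last exact.
by apply: (@filterS _ (nbhs x) _ _ _ _ xmax') => y; rewrite lerN2.
Qed.

Lemma local_min_pos_ball (h : R -> R) (x : R) : local_min_point `]0, +oo[ h x ->
  0 < x /\ exists2 e : R, 0 < e & forall y, `|x - y| < e -> 0 < y /\ h x <= h y.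
Proof.
move=> [/=]; rewrite in_itv/= andbT => x0 xmin; split => //.
have xmin' : nbhs x (fun y => `]0, +oo[%classic y -> h x <= h y) by exact: xmin.
have h2 : nbhs x (fun y => (`]0, +oo[%classic y -> h x <= h y) /\ 0 < y).
  by apply: filterI => //; exact: lt_nbhsr.
move/nbhs_ballP : h2 => [e /= e0 he].
exists e => // y ye; have [hy y0] := he y ye; split => //.
by apply: hy; rewrite /= in_itv/= andbT.
Qed.

Lemma local_min_pos_derive0 (h dh : R -> R) (x : R) :
  local_min_point `]0, +oo[ h x ->
  (forall t : R, 0 < t -> is_derive t 1 h (dh t)) -> dh x = 0.
Proof.
move=> /local_min_pos_ball[x0 [e e0 he]] hd.
have [||||_ <-] := @derive1_at_min R h (x - e) (x + e) x.
- lra.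
- move=> t; rewrite in_itv/= => /andP[t1 t2].
  have [|t0 _] := he t; first by rewrite ltr_norml; lra.
  by have [] := hd t t0.
- by rewrite in_itv/=; lra.
- move=> t; rewrite in_itv/= => /andP[t1 t2].
  by have [|_ ->] := he t; first by rewrite ltr_norml; lra.
by have [_ ->] := hd x x0.
Qed.

End LocalExtrema.

(** * Derivative, signs and zeros of the AFM force *)

Section Force.
Context {R : realType}.
Variables (b1 b2 a : R).
Hypotheses (b1_gt0 : 0 < b1) (b2_gt0 : 0 < b2) (a_gt0 : 0 < a).
Local Notation m := (afm_m b1 b2).
Local Notation f := (fun x : R => afm_m b1 b2 x + a).

Definition afm_cubic (z : R) : R := - z ^+ 3 + 2 * b2 * z ^+ 2 - 8 * b1.
Definition afm_dm (x : R) : R := afm_cubic (x ^+ 3) / x ^+ 9.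

Lemma afm_m_derive (x : R) : 0 < x -> is_derive x 1 m (afm_dm x).
Proof.
move=> x0; have xN : x != 0 by rewrite gt_eqF.
have dX n : is_derive x 1 (fun y : R => y ^+ n) (n%:R * x ^+ n.-1).
  apply: DeriveDef; first exact: exprn_derivable.
  by rewrite exp_derive /GRing.scale/= mulr1.
have d8 := dX 8%N; have d2 := dX 2%N.
have dV8 := @is_deriveV _ (fun y : R => y ^+ 8) _ _ _ (expf_neq0 8 xN) d8.
have dV2 := @is_deriveV _ (fun y : R => y ^+ 2) _ _ _ (expf_neq0 2 xN) d2.
have -> : m = b1 *: (fun y : R => (y ^+ 8)^-1) - id - b2 *: (fun y : R => (y ^+ 2)^-1).
  by apply/funext => y; rewrite /afm_m !fctE.
by apply: is_derive_eq; rewrite /GRing.scale/= /afm_dm /afm_cubic; field.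
Qed.

Lemma afm_derive (x : R) : 0 < x -> is_derive x 1 f (afm_dm x).
Proof.
move=> x0; have ? := afm_m_derive x0.
by apply: is_derive_eq; rewrite addr0.
Qed.

Lemma afm_dm_gt0 (x : R) : 0 < x -> (0 < afm_dm x) = (0 < afm_cubic (x ^+ 3)).
Proof. by move=> x0; rewrite /afm_dm pmulr_lgt0// invr_gt0 exprn_gt0. Qed.

Lemma afm_dm_lt0 (x : R) : 0 < x -> (afm_dm x < 0) = (afm_cubic (x ^+ 3) < 0).
Proof. by move=> x0; rewrite /afm_dm pmulr_llt0// invr_gt0 exprn_gt0. Qed.

Lemma afm_dm_eq0 (x : R) : 0 < x -> afm_dm x = 0 -> afm_cubic (x ^+ 3) = 0.
Proof.
move=> x0 /eqP; rewrite /afm_dm mulf_eq0 invr_eq0 expf_eq0/= (gt_eqF x0) orbF.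
by move/eqP.
Qed.

Lemma afm_incr (u v : R) : 0 < u -> u < v ->
  (forall t, u < t < v -> 0 < afm_dm t) -> f u < f v.
Proof.
move=> u0 uv h; apply: (@is_derive1_gt0_lt _ f afm_dm _ _ uv) => [t /andP[ut _]|]; last exact: h.
by apply: afm_derive; exact: (lt_le_trans u0 ut).
Qed.

Lemma afm_decr (u v : R) : 0 < u -> u < v ->
  (forall t, u < t < v -> afm_dm t < 0) -> f v < f u.
Proof.
move=> u0 uv h; rewrite -ltrN2.
apply: (@is_derive1_gt0_lt _ (fun t => - f t) (fun t => - afm_dm t) _ _ uv) => t tuv.
  apply: is_deriveN; apply: afm_derive; case/andP: tuv => ut _; exact: (lt_le_trans u0 ut).
by rewrite oppr_gt0 h.
Qed.

(** The exceptional point accommodates the critical inflection that [m] has when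
    [b1 = b1_star b2]. *)
Lemma afm_decr_except (r u v : R) : 0 < u -> u < v ->
  (forall t, u < t < v -> t != r -> afm_dm t < 0) -> f v < f u.
Proof.
move=> u0 uv h; have [/andP[ur rv]|nr] := boolP (u < r < v).
  apply: (@lt_trans _ _ (f r)).
    apply: afm_decr => //; first exact: lt_trans ur.
    by move=> t /andP[rt tv]; apply: h; rewrite ?tv ?gt_eqF// (lt_trans ur).
  apply: afm_decr => // t /andP[ut tr]; apply: h; last by rewrite lt_eqF.
  by rewrite ut (lt_trans tr).
by apply: afm_decr => // t tuv; apply: h => //; apply: contraNneq nr => <-.
Qed.

Lemma afm_lipschitz (c d : R) : 0 < c -> exists2 L, 0 <= L &
  forall x y, c <= x <= d -> c <= y <= d -> `|f x - f y| <= L * `|x - y|.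
Proof.
(* The absolute values at [c] of the three terms of [afm_dm], none of which grows for [x >= c]. *)
move=> c0; pose L := 8 * b1 / c ^+ 9 + 1 + 2 * b2 / c ^+ 3.
have dL x : c <= x -> `|afm_dm x| <= L.
  move=> cx; have x0 := lt_le_trans c0 cx; have xN : x != 0 by rewrite gt_eqF.
  have -> : afm_dm x = - (8 * b1 / x ^+ 9) - 1 + 2 * b2 / x ^+ 3.
    by rewrite /afm_dm /afm_cubic; field.
  have inv n : (x ^+ n)^-1 <= (c ^+ n)^-1.
    rewrite lef_pV2 ?posrE ?exprn_gt0//.
    by apply: lerXn2r => //; rewrite nnegrE ltW.
  have h1 : 8 * b1 / x ^+ 9 <= 8 * b1 / c ^+ 9 by rewrite ler_pM2l ?inv// mulr_gt0.
  have h2 : 2 * b2 / x ^+ 3 <= 2 * b2 / c ^+ 3 by rewrite ler_pM2l ?inv// mulr_gt0.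
  have h3 : 0 < 8 * b1 / x ^+ 9 by rewrite divr_gt0 ?exprn_gt0// mulr_gt0.
  have h4 : 0 < 2 * b2 / x ^+ 3 by rewrite divr_gt0 ?exprn_gt0// mulr_gt0.
  by rewrite ler_norml /L; apply/andP; split; lra.
have L0 : 0 <= L by apply: le_trans (dL c (lexx _)).
exists L => // x y; wlog xy : x y / y <= x => [H hx hy|/andP[cx _] /andP[cy _]].
  have [h|/ltW h] := leP y x; first exact: H.
  by rewrite distrC (distrC x); exact: H.
have [|r /andP[yr _] ->] := is_derive1_MVT (f := f) (df := afm_dm) xy.
  by move=> t /andP[yt _]; apply: afm_derive; exact: lt_le_trans (le_trans cy yt).
by rewrite normrM ler_wpM2r// dL// (le_trans cy).
Qed.

Lemma afm_pos_near0 (B : R) : 0 < B -> exists2 c, 0 < c < B & 0 < f c.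
Proof.
(* Multiplied by [c ^+ 8], [m] becomes [b1 - c ^+ 9 - b2 * c ^+ 6]. As powers of [c <= 1] are at
   most [c], the last two bounds leave at least [b1 / 4]. *)
move=> B0; pose c := Num.min (B / 2) (Num.min (1 / 2) (Num.min (b1 / (2 * b2)) (b1 / 4))).
have [c1 c2 c3 c4] : [/\ c <= B / 2, c <= 1 / 2, c <= b1 / (2 * b2) & c <= b1 / 4].
  by rewrite /c !ge_min !lexx !orbT.
have c0 : 0 < c by rewrite !lt_min !divr_gt0// mulr_gt0.
exists c; first by rewrite c0; lra.
have c_le1 : c <= 1 by lra.
have c6 : c ^+ 6 <= c by rewrite exprS ler_piMr ?exprn_ile1// ltW.
have c9 : c ^+ 9 <= c by rewrite exprS ler_piMr ?exprn_ile1// ltW.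
have cN : c != 0 by rewrite gt_eqF.
have -> : f c = (b1 - c ^+ 9 - b2 * c ^+ 6) / c ^+ 8 + a by rewrite /afm_m; field.
apply: addr_gt0 => //; apply: divr_gt0; last exact: exprn_gt0.
have : b2 * c ^+ 6 <= b1 / 2.
  apply: (@le_trans _ _ (b2 * (b1 / (2 * b2)))).
    by rewrite ler_pM2l// (le_trans c6).
  by rewrite le_eqVlt; apply/orP; left; apply/eqP; field; rewrite gt_eqF.
by have := b1_gt0; lra.
Qed.

Lemma afm_neg_far (B : R) : exists2 d, B < d & f d < 0.
Proof.
(* Since [d >= 1], the repulsive term is at most [b1], and [- d] outweighs [a + b1]. *)
pose d := Num.max (B + 1) (a + b1 + 1).
have [d1 d2] : B + 1 <= d /\ a + b1 + 1 <= d by rewrite /d !le_max !lexx !orbT.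
exists d; first by lra.
have ab := a_gt0; have bb := b1_gt0; have d_ge1 : 1 <= d by lra.
have d0 : 0 < d by lra.
have : b1 / d ^+ 8 <= b1.
  by rewrite ler_pdivrMr ?exprn_gt0// ler_peMr ?exprn_ege1// ltW.
have : 0 < b2 / d ^+ 2 by rewrite divr_gt0 ?exprn_gt0.
by rewrite /afm_m; lra.
Qed.

Lemma afm_zero (u v : R) : 0 < u -> u < v ->
  (f u < 0 < f v) \/ (f v < 0 < f u) -> exists2 z, u < z < v & f z = 0.
Proof.
move=> u0 uv h.
have [||z] := @IVT R f u v 0 (ltW uv).
- apply: (@is_derive1_within _ f afm_dm) => t /andP[ut _].
  by apply: afm_derive; exact: lt_le_trans ut.
- by case: h => /andP[/ltW h1 /ltW h2]; rewrite ge_min le_max h1 h2 ?orbT.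
rewrite in_itv/= => /andP[uz zv] fz; exists z => //.
rewrite !lt_neqAle uz zv !andbT; apply/andP; split; apply/eqP => e.
  by rewrite e fz ltxx andbF in h; case: h.
by rewrite -e fz ltxx andbF in h; case: h.
Qed.

Lemma afm_center (u v x0 : R) : 0 <= u -> u < x0 -> x0 < v -> f x0 = 0 ->
  (forall s t, u < s -> s < t -> t < v -> f t < f s) ->
  nonlinear_center (afm_field b1 b2 a) right_half_plane (vec2 x0 0).
Proof.
move=> u0 ux xv fx mono.
have [c [c1 c2 c3]] : exists c, [/\ u < c, c < x0 & 0 < c].
  by exists ((u + x0) / 2); split; lra.
have [d [d1 d2]] : exists d, x0 < d /\ d < v by exists ((x0 + v) / 2); split; lra.
have [L L0 fL] := afm_lipschitz d c3.
apply: (@newton_nonlinear_center R f right_half_plane L c x0 d) => //.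
- by move=> x cx xx0; rewrite -fx; apply: mono => //; exact: lt_le_trans c1 cx.
- by move=> x x0x xd; rewrite -fx; apply: mono => //; exact: le_lt_trans d2.
- by move=> p /andP[cp _]; exact: lt_trans cp.
Qed.

Lemma afm_equilibria (p : 'rV[R]_2) :
  equilibria (afm_field b1 b2 a) right_half_plane p <->
  [/\ 0 < p ord0 0, f (p ord0 0) = 0 & p ord0 1 = 0].
Proof. exact: (newton_field_equilibria f). Qed.

(** The abscissa where [afm_cubic (x ^+ 3)] peaks; for [b1 = b1_star b2] it is the only critical
    point of [m]. *)
Lemma afm_cbrt : exists2 r : R, 0 < r & r ^+ 3 = 4 / 3 * b2.
Proof.
have bb := b2_gt0.
have [|||r] := @IVT R (fun x => x ^+ 3) 0 (1 + 4 / 3 * b2) (4 / 3 * b2).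
- lra.
- by apply: continuous_subspaceT; exact: exprn_continuous.
- rewrite expr0n/= ge_min le_max; apply/andP; split; apply/orP; [left|right]; first lra.
  apply: (@le_trans _ _ (1 + 4 / 3 * b2)); first lra.
  rewrite exprS ler_peMr//; first lra.
  by rewrite exprn_ege1//; lra.
rewrite in_itv/= => /andP[r0 _] r3; exists r => //.
rewrite lt_neqAle r0 andbT; apply/eqP => e; move: r3; rewrite -e expr0n/=; lra.
Qed.

Lemma afm_one_center : b1_star b2 <= b1 -> one_center (afm_field b1 b2 a) right_half_plane.
Proof.
rewrite /b1_star => hb.
have [r r0 r3] := afm_cbrt.
have mono s t : 0 < s -> s < t -> f t < f s.
  move=> s0 st; apply: (afm_decr_except (r := r)) => // x /andP[sx _] xr.
  have x0 := lt_trans s0 sx.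
  rewrite afm_dm_lt0//; set z := x ^+ 3.
  have z0 : 0 < z by rewrite exprn_gt0.
  have zN : z != 4 / 3 * b2.
    by rewrite -r3 /z eqrXn2// ltW.
  (* This form exhibits the double contact at the peak [4 / 3 * b2] and the peak value
     [8 * (b1_star b2 - b1)]. *)
  have -> : afm_cubic z = - ((z - 4 / 3 * b2) ^+ 2 * (z + 2 / 3 * b2)) + 8 * (4 / 27 * b2 ^+ 3 - b1).
    by rewrite /afm_cubic; field.
  have : 0 < (z - 4 / 3 * b2) ^+ 2 * (z + 2 / 3 * b2).
    apply: mulr_gt0; last by have := b2_gt0; lra.
    by rewrite exprn_even_gt0//= subr_eq0.
  by lra.
have [c /andP[c0 _] fc] := afm_pos_near0 ltr01.
have [d cd fd] := afm_neg_far c.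
have [|z /andP[cz zd] fz] := afm_zero c0 cd; first by right; rewrite fd fc.
have z0 := lt_trans c0 cz.
exists (vec2 z 0); split; last first.
  by apply: (@afm_center 0 (z + 1) z) => //; [rewrite ltrDl|move=> s t s0 st _; exact: mono].
apply/seteqP; split => [p /afm_equilibria[p0 fp yp]|_ ->].
  apply: row2P; rewrite ?vec2E0 ?vec2E1//.
  have [h|h|//] := ltgtP (p ord0 0) z.
    by have := mono _ _ p0 h; rewrite fp fz ltxx.
  by have := mono _ _ z0 h; rewrite fp fz ltxx.
by apply/afm_equilibria; rewrite vec2E0 vec2E1.
Qed.

(** * The force with two extrema and the count of its zeros *)

Section TwoExtrema.
Variables xl xr : R.
Hypothesis hb : b1 < b1_star b2.

(* The point where [afm_cubic] is maximal on the positive axis. *)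
Let q : R := 4 / 3 * b2.

Let q_gt0 : 0 < q. Proof. by rewrite /q mulr_gt0. Qed.

Let b2q : b2 = 3 / 4 * q. Proof. by rewrite /q; field. Qed.

Let cubic_q : 0 < afm_cubic q.
Proof.
have -> : afm_cubic q = 8 * (4 / 27 * b2 ^+ 3 - b1) by rewrite /afm_cubic /q; field.
by rewrite mulr_gt0// subr_gt0.
Qed.

(** Factored so that every product in the second factor has the same sign when [z] and [w] lie on
    one side of [q]. *)
Let cubicB (z w : R) : afm_cubic w - afm_cubic z =
  (w - z) * (w * (q - w) + z * (q - z) + (w * (q - z) + z * (q - w)) / 2).
Proof. by rewrite /afm_cubic b2q; field. Qed.

Let cubic_incr (z w : R) : 0 < z -> z < w -> w <= q -> afm_cubic z < afm_cubic w.
Proof.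
move=> z0 zw wq; rewrite -subr_gt0 cubicB mulr_gt0 ?subr_gt0//.
have zq := lt_le_trans zw wq; have w0 := lt_trans z0 zw.
have h1 : 0 < z * (q - z) by rewrite mulr_gt0// subr_gt0.
have h2 : 0 <= w * (q - w) by rewrite mulr_ge0 ?subr_ge0// ltW.
have h3 : 0 <= w * (q - z) by rewrite mulr_ge0 ?subr_ge0// ltW.
have h4 : 0 <= z * (q - w) by rewrite mulr_ge0 ?subr_ge0// ltW.
by lra.
Qed.

Let cubic_decr (z w : R) : q <= z -> z < w -> afm_cubic w < afm_cubic z.
Proof.
move=> qz zw; have z0 := lt_le_trans q_gt0 qz; have w0 := lt_trans z0 zw.
have qw := le_lt_trans qz zw.
rewrite -subr_lt0 cubicB pmulr_rlt0 ?subr_gt0//.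
have h1 : w * (q - w) < 0 by rewrite pmulr_rlt0// subr_lt0.
have h2 : z * (q - z) <= 0 by rewrite pmulr_rle0// subr_le0.
have h3 : w * (q - z) <= 0 by rewrite pmulr_rle0// subr_le0.
have h4 : z * (q - w) <= 0 by rewrite pmulr_rle0// subr_le0 ltW.
by lra.
Qed.

Lemma afm_root_side (x : R) : 0 < x -> afm_dm x = 0 -> x ^+ 3 != q.
Proof.
move=> x0 /(afm_dm_eq0 x0) e; apply/eqP => xq.
by have := cubic_q; rewrite -xq e ltxx.
Qed.

Let cube_lt (x y : R) : 0 < x -> 0 < y -> (x ^+ 3 < y ^+ 3) = (x < y).
Proof. by move=> x0 y0; rewrite (ltr_pXn2r (n := 3))// nnegrE ltW. Qed.

Let rq : exists2 r : R, 0 < r & r ^+ 3 = q. Proof. exact: afm_cbrt. Qed.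

Hypotheses (xl_min : local_min_point `]0, +oo[ m xl)
  (xr_max : local_max_point `]0, +oo[ m xr).

Let m_derive (t : R) : 0 < t -> is_derive t 1 m (afm_dm t).
Proof. exact: afm_m_derive. Qed.

Let Nm_derive (t : R) : 0 < t -> is_derive t 1 (fun x => - m x) (- afm_dm t).
Proof. by move=> t0; apply: is_deriveN; exact: afm_m_derive. Qed.

Let xl_gt0 : 0 < xl. Proof. by have [] := local_min_pos_ball xl_min. Qed.

Let xr_gt0 : 0 < xr.
Proof. by have [] := local_min_pos_ball (local_max_opp xr_max). Qed.

Let dm_xl : afm_dm xl = 0.
Proof. exact: (local_min_pos_derive0 xl_min m_derive). Qed.

Let dm_xr : afm_dm xr = 0.
Proof.
apply: oppr_inj; rewrite oppr0.
exact: (local_min_pos_derive0 (local_max_opp xr_max) Nm_derive).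
Qed.

Let xl_cubic : afm_cubic (xl ^+ 3) = 0. Proof. exact: afm_dm_eq0. Qed.
Let xr_cubic : afm_cubic (xr ^+ 3) = 0. Proof. exact: afm_dm_eq0. Qed.

(** Past [q] the cubic decreases to its zero at [xl ^+ 3], hence is positive just before it; [m]
    would increase up to [xl], against minimality. The case of [xr] mirrors this. *)
Let xl_lt : xl ^+ 3 < q.
Proof.
rewrite lt_neqAle afm_root_side//= leNgt; apply/negP => qx.
have [r r0 r3] := rq; have rx : r < xl by rewrite -cube_lt// r3.
have [_ [e e0 he]] := local_min_pos_ball xl_min.
pose y := Num.max ((r + xl) / 2) (xl - e / 2).
have [y1 y2 y3] : [/\ r < y, xl - e < y & y < xl].
  by rewrite /y gt_max !lt_max; split; [apply/orP; left|apply/orP; right|apply/andP; split]; lra.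
have [|y0 my] := he y; first by rewrite gtr0_norm; lra.
have : f y < f xl.
  apply: afm_incr => // t /andP[yt tx]; have t0 := lt_trans y0 yt.
  rewrite afm_dm_gt0// -xl_cubic cubic_decr// ?cube_lt//.
  by rewrite -r3 ltW// cube_lt// (lt_trans y1).
by rewrite ltrD2r ltNge my.
Qed.

Let xr_gt : q < xr ^+ 3.
Proof.
rewrite lt_neqAle eq_sym afm_root_side//= leNgt; apply/negP => qx.
have [r r0 r3] := rq; have rx : xr < r by rewrite -cube_lt// r3.
have [_ [e e0 he]] := local_min_pos_ball (local_max_opp xr_max).
pose y := Num.min ((r + xr) / 2) (xr + e / 2).
have [y1 y2 y3] : [/\ y < r, y < xr + e & xr < y].
  by rewrite /y lt_min !gt_min; split; [apply/orP; left|apply/orP; right|apply/andP; split]; lra.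
have [|y0 my] := he y; first by rewrite ltr0_norm; lra.
have : f xr < f y.
  apply: afm_incr => // t /andP[xt ty]; have t0 := lt_trans xr_gt0 xt.
  rewrite afm_dm_gt0// -xr_cubic cubic_incr// ?cube_lt// ?exprn_gt0//.
  by rewrite -r3 ltW// cube_lt// (lt_trans ty).
by rewrite ltrD2r ltNge -lerN2 my.
Qed.

Let xl_xr : xl < xr. Proof. by rewrite -cube_lt// (lt_trans xl_lt). Qed.

Let decrL (s t : R) : 0 < s -> s < t -> t <= xl -> f t < f s.
Proof.
move=> s0 st tx; apply: afm_decr => // r /andP[sr rt].
have r0 := lt_trans s0 sr.
rewrite afm_dm_lt0// -xl_cubic cubic_incr ?exprn_gt0//; last exact: ltW.
by rewrite cube_lt// (lt_le_trans rt).
Qed.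

(** The cubic vanishes at both ends and rises then falls, with its peak [q] in between. *)
Let mid_gt0 (r : R) : xl < r -> r < xr -> 0 < afm_dm r.
Proof.
move=> xr1 rx; have r0 := lt_trans xl_gt0 xr1; rewrite afm_dm_gt0//.
have [rq3|qr3] := leP (r ^+ 3) q.
  by rewrite -xl_cubic cubic_incr// ?exprn_gt0// cube_lt.
by rewrite -xr_cubic cubic_decr// ?cube_lt// ltW.
Qed.

Let incrM (s t : R) : xl <= s -> s < t -> t <= xr -> f s < f t.
Proof.
move=> xs st tx; apply: afm_incr => //; first exact: lt_le_trans xs.
by move=> r /andP[sr rt]; apply: mid_gt0; [exact: le_lt_trans sr|exact: lt_le_trans tx].
Qed.

Let decrR (s t : R) : xr <= s -> s < t -> f t < f s.
Proof.
move=> xs st; have s0 := lt_le_trans xr_gt0 xs; apply: afm_decr => // r /andP[sr _].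
have r0 := lt_trans s0 sr; have xr1 := le_lt_trans xs sr.
by rewrite afm_dm_lt0// -xr_cubic cubic_decr// ?cube_lt// ltW.
Qed.

Let decrL_le (s t : R) : 0 < s -> s <= t -> t <= xl -> f t <= f s.
Proof. by move=> s0; rewrite le_eqVlt => /orP[/eqP->//|st tx]; exact/ltW/decrL. Qed.

Let incrM_le (s t : R) : xl <= s -> s <= t -> t <= xr -> f s <= f t.
Proof. by move=> xs; rewrite le_eqVlt => /orP[/eqP->//|st tx]; exact/ltW/incrM. Qed.

Let decrR_le (s t : R) : xr <= s -> s <= t -> f t <= f s.
Proof. by move=> xs; rewrite le_eqVlt => /orP[/eqP->//|st]; exact/ltW/decrR. Qed.

Let center_left : f xl < 0 ->
  exists z, [/\ 0 < z, z < xl, f z = 0,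
    nonlinear_center (afm_field b1 b2 a) right_half_plane (vec2 z 0) &
    forall x, 0 < x -> x <= xl -> f x = 0 -> x = z].
Proof.
move=> fl; have [c /andP[c0 cx] fc] := afm_pos_near0 xl_gt0.
have [|z /andP[cz zx] fz] := afm_zero c0 cx; first by right; rewrite fl fc.
have z0 := lt_trans c0 cz; exists z; split => //.
  by apply: (@afm_center 0 xl z) => // s t s0 st tx; apply: decrL => //; exact: ltW.
move=> x x0 xx fx; have [h|h|//] := ltgtP x z.
  by have := decrL x0 h (ltW zx); rewrite fx fz ltxx.
by have := decrL z0 h xx; rewrite fx fz ltxx.
Qed.

Let center_right : 0 < f xr ->
  exists z, [/\ xr < z, f z = 0,
    nonlinear_center (afm_field b1 b2 a) right_half_plane (vec2 z 0) &
    forall x, xr <= x -> f x = 0 -> x = z].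
Proof.
move=> fr; have [d xd fd] := afm_neg_far xr.
have [|z /andP[xz zd] fz] := afm_zero xr_gt0 xd; first by right; rewrite fd fr.
exists z; split => //.
  apply: (@afm_center xr (z + 1) z) => //; first exact: ltW.
    by rewrite ltrDl.
  by move=> s t xs st _; apply: decrR => //; exact: ltW.
move=> x xx fx; have [h|h|//] := ltgtP x z.
  by have := decrR xx h; rewrite fx fz ltxx.
by have := decrR (ltW xz) h; rewrite fx fz ltxx.
Qed.

Let f_xl_xr : f xl < f xr. Proof. exact: incrM. Qed.

Let equilibria_vec2 (p : 'rV[R]_2) (z : R) : p ord0 1 = 0 -> p ord0 0 = z -> p = vec2 z 0.
Proof. by move=> h1 h0; apply: row2P; rewrite ?vec2E0 ?vec2E1. Qed.

Let vec2_inj (z w : R) : z != w -> vec2 z 0 != vec2 w 0.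
Proof.
apply: contraNneq => /(congr1 (fun v : 'rV[R]_2 => v ord0 0)).
by rewrite !vec2E0 => ->.
Qed.

(** When [f xr < 0] only the left decreasing branch reaches zero; when [f xl > 0] only the right one
    does. *)
Lemma afm_one_center_outside : ~ (- m xr <= a <= - m xl) ->
  one_center (afm_field b1 b2 a) right_half_plane.
Proof.
move=> /negP; rewrite negb_and -!ltNge => /orP[ar|al].
  have fr : f xr < 0 by lra.
  have [z [z0 zx fz cz uz]] := center_left (lt_trans f_xl_xr fr).
  exists (vec2 z 0); split => //.
  apply/seteqP; split => [p /afm_equilibria[p0 fp yp]|_ ->]; last first.
    by apply/afm_equilibria; rewrite vec2E0 vec2E1.
  apply: equilibria_vec2 => //; apply: uz => //.
  rewrite leNgt; apply/negP => px.
  have : f (p ord0 0) <= f xr.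
    have [h|h] := leP (p ord0 0) xr; first by apply: incrM_le => //; exact: ltW.
    by apply: decrR_le => //; exact: ltW.
  by rewrite fp leNgt fr.
have fl : 0 < f xl by lra.
have [z [zx fz cz uz]] := center_right (lt_trans fl f_xl_xr).
have z0 := lt_trans xr_gt0 zx.
exists (vec2 z 0); split => //.
apply/seteqP; split => [p /afm_equilibria[p0 fp yp]|_ ->]; last first.
  by apply/afm_equilibria; rewrite vec2E0 vec2E1.
apply: equilibria_vec2 => //; apply: uz => //.
rewrite leNgt; apply/negP => px.
have : f xl <= f (p ord0 0).
  have [h|h] := leP (p ord0 0) xl; first exact: decrL_le.
  by apply: incrM_le => //; exact: ltW.
by rewrite fp leNgt fl.
Qed.

Lemma afm_two_centers_one_saddle : - m xr < a < - m xl ->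
  two_centers_one_saddle (afm_field b1 b2 a) right_half_plane.
Proof.
move=> /andP[ar al]; have fr : 0 < f xr by lra.
have fl : f xl < 0 by lra.
have [z1 [z10 z1x fz1 cz1 uz1]] := center_left fl.
have [z2 [z2x fz2 cz2 uz2]] := center_right fr.
have [|z3 /andP[xz3 z3x] fz3] := afm_zero xl_gt0 xl_xr; first by left; rewrite fl fr.
have z20 := lt_trans xr_gt0 z2x; have z30 := lt_trans xl_gt0 xz3.
exists (vec2 z1 0), (vec2 z2 0), (vec2 z3 0); split => //.
- split; apply: vec2_inj.
  + by rewrite lt_eqF// (lt_trans z1x)// (lt_trans xl_xr).
  + by rewrite lt_eqF// (lt_trans z1x).
  + by rewrite gt_eqF// (lt_trans z3x).
- apply/seteqP; split => [p /afm_equilibria[p0 fp yp]|p]; last first.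
    by case=> [[->|->]|->]; apply/afm_equilibria; rewrite vec2E0 vec2E1.
  have [h|h] := leP (p ord0 0) xl; first by left; left; apply: equilibria_vec2 => //; exact: uz1.
  have [h'|h'] := leP xr (p ord0 0); first by left; right; apply: equilibria_vec2 => //; exact: uz2.
  right; apply: equilibria_vec2 => //.
  have [k|k|//] := ltgtP (p ord0 0) z3.
    by have := incrM (ltW h) k (ltW z3x); rewrite fp fz3 ltxx.
  by have := incrM (ltW xz3) k (ltW h'); rewrite fp fz3 ltxx.
- apply: (@newton_saddle R f right_half_plane z3 (afm_dm z3)) => //.
  + exact: mid_gt0.
  + exact: afm_derive.
  + by rewrite /right_half_plane /= vec2E0.
Qed.

(** At [a = - m xr] the force touches zero from below at its local maximum, and at [a = - m xl] from
    above at its local minimum: the two signs of the cusp criterion. *)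
Lemma afm_one_center_one_cusp : a = - m xr \/ a = - m xl ->
  one_center_one_cusp (afm_field b1 b2 a) right_half_plane.
Proof.
case=> am.
  have fr : f xr = 0 by rewrite [X in _ + X]am subrr.
  have fl : f xl < 0 by rewrite -fr.
  have [z [z0 zx fz cz uz]] := center_left fl.
  exists (vec2 z 0), (vec2 xr 0); split => //.
  - by apply: vec2_inj; rewrite lt_eqF// (lt_trans zx).
  - apply/seteqP; split => [p /afm_equilibria[p0 fp yp]|p]; last first.
      by case=> ->; apply/afm_equilibria; rewrite vec2E0 vec2E1.
    have [h|h] := leP (p ord0 0) xl; first by left; apply: equilibria_vec2 => //; exact: uz.
    right; apply: equilibria_vec2 => //; have [k|k|//] := ltgtP (p ord0 0) xr.
      by have := incrM (ltW h) k (lexx _); rewrite fp fr ltxx.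
    by have := decrR (lexx _) k; rewrite fp fr ltxx.
  have [c [c1 c2]] : exists c, xl < c /\ c < xr.
    by have := xl_xr => ?; exists ((xl + xr) / 2); split; lra.
  have c0 := lt_trans xl_gt0 c1.
  have [L L0 fL] := afm_lipschitz (xr + 1) c0.
  apply: (@newton_cusp_neg R f right_half_plane L c xr (xr + 1)) => //.
  - by rewrite ltrDl.
  - move=> x /andP[cx _] xN; rewrite -fr.
    have [k|k|k] := ltgtP x xr; last by rewrite k eqxx in xN.
      by apply: incrM => //; exact: le_trans (ltW c1) cx.
    exact: decrR.
  - by rewrite -dm_xr; exact: afm_derive.
  - by move=> p /andP[cp _]; exact: (lt_trans c0 cp).
have fl : f xl = 0 by rewrite [X in _ + X]am subrr.
have fr : 0 < f xr by rewrite -fl.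
have [z [zx fz cz uz]] := center_right fr.
have z0 := lt_trans xr_gt0 zx.
exists (vec2 z 0), (vec2 xl 0); split => //.
- by apply: vec2_inj; rewrite gt_eqF// (lt_trans xl_xr).
- apply/seteqP; split => [p /afm_equilibria[p0 fp yp]|p]; last first.
    by case=> ->; apply/afm_equilibria; rewrite vec2E0 vec2E1.
  have [h|h] := leP xr (p ord0 0); first by left; apply: equilibria_vec2 => //; exact: uz.
  right; apply: equilibria_vec2 => //; have [k|k|//] := ltgtP (p ord0 0) xl.
    by have := decrL p0 k (lexx _); rewrite fp fl ltxx.
  by have := incrM (lexx _) k (ltW h); rewrite fp fl ltxx.
have c0 : 0 < xl / 2 by rewrite divr_gt0.
have [L L0 fL] := afm_lipschitz xr c0.
apply: (@newton_cusp_pos R f right_half_plane L (xl / 2) xl xr) => //.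
- by have := xl_gt0 => ?; lra.
- move=> x /andP[cx xd] xN; rewrite -fl.
  have [k|k|k] := ltgtP x xl; last by rewrite k eqxx in xN.
    by apply: decrL => //; exact: lt_le_trans cx.
  exact: incrM.
- by rewrite -dm_xl; exact: afm_derive.
- by move=> p /andP[cp _]; exact: (lt_trans c0 cp).
Qed.

End TwoExtrema.

End Force.

Theorem theorem1 (R : realType) (b1 b2 a : R)
    (hb1 : 0 < b1) (hb2 : 0 < b2) (ha : 0 < a) :
  let m := afm_m b1 b2 in
  let F := afm_field b1 b2 a in
  let D := right_half_plane in
  (b1_star b2 <= b1 -> one_center F D) /\
  (b1 < b1_star b2 ->
   forall xl xr : R,
     local_min_point `]0, +oo[ m xl ->
     local_max_point `]0, +oo[ m xr ->
     [/\ ~ (- m xr <= a <= - m xl) -> one_center F D,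
         - m xr < a < - m xl -> two_centers_one_saddle F D &
         a = - m xr \/ a = - m xl -> one_center_one_cusp F D]).
Proof.
move=> m F D; split; first exact: afm_one_center.
move=> hb xl xr xl_min xr_max; split.
- exact: (afm_one_center_outside hb1 hb2 ha hb xl_min xr_max).
- exact: (afm_two_centers_one_saddle hb1 hb2 ha hb xl_min xr_max).
- exact: (afm_one_center_one_cusp hb1 hb2 ha hb xl_min xr_max).
Qed.
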